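(* Assume that the following (conjectural) statement is valid: for every $\alpha\in\left[\frac12,\frac23\right)$, with $K=n^\alpha$, w.h.p. as $n\to\infty$, $\Psi^{\mathcal{R}}_K\ge L(n,K)-o(K\log n)$. Then there exists $C_0>0$ such that for $\alpha\in\left[\frac12,\frac23\right)$ and $K=n^\alpha$ the following holds. There exist constants $C_1>0$ and $0<D_1<D_2$ such that w.h.p. as $n\to\infty$ $$\max_{z\in I}\Psi^{\mathrm{Bern}(1/2)}_K(z)\ \le\ \min\left\{\Psi^{\mathrm{Bern}(1/2)}_K\left(\left\lfloor C_0\tfrac{K^2}{n}\right\rfloor\right),\ \Psi^{\mathrm{Bern}(1/2)}_K\left(\left\lfloor\tfrac K2\right\rfloor\right)\right\}-C_1K\log K,$$ where $I=\mathbb{Z}\cap\left[D_1\sqrt{K\log K},\,D_2\sqrt{K\log K}\right]$. Namely, the planted clique model $\mathbb{G}(n,K,\mathrm{Bern}(1/2))$ exhibits the Overlap Gap Property with parameters $(\zeta_{1,n},\zeta_{2,n},r^1_n,r^2_n)$ given by $\zeta_{i,n}=D_i\sqrt{K\log K}$ $(i=1,2)$, $$r^2_n=\min\left\{\Psi^{\mathrm{Bern}(1/2)}_K\left(\left\lfloor C_0\tfrac{K^2}{n}\right\rfloor\right),\Psi^{\mathrm{Bern}(1/2)}_K\left(\left\lfloor\tfrac K2\right\rfloor\right)\right\},\qquad r^1_n=r^2_n-C_1K\log K.$$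
   Context: $K=n^\alpha$ is regarded as an integer, i.e. $K=\lfloor n^\alpha\rfloor$. Unplanted model (for the assumption): let $Z_{ij}$, $1\le i<j\le n$, be i.i.d. Rademacher ($\pm1$ with probability $1/2$ each), $Z_S=\sum_{1\le i<j\le n,\ i,j\in S}Z_{ij}$, $\Psi^{\mathcal{R}}_K=\max_{S\subset\{1,\dots,n\},|S|=K}Z_S$, and $L(n,K)=\sqrt{2\binom K2\log\left(\binom nK\frac1K\right)}$. The assumed bound means that for every $\varepsilon>0$, $\Psi^{\mathcal{R}}_K\ge L(n,K)-\varepsilon K\log n$ with probability tending to $1$. The planted clique model $\mathbb{G}(n,K,\mathrm{Bern}(1/2))$: a random graph on $\{1,\dots,n\}$ with planted clique vertex set $\mathcal{PC}=\{1,\dots,K\}$; the edge indicators are $Z_{ij}=1$ if $1\le i<j\le K$, and $Z_{ij}$ i.i.d. Bernoulli$(1/2)$ for all other pairs $i<j$. For $S\subset\{1,\dots,n\}$, $Z_S=\sum_{1\le i<j\le n,\ i,j\in S}Z_{ij}$, also written $|E[S]|$. For integers $z$ with $\lfloor K^2/n\rfloor\le z\le K$, $$\Psi^{\mathrm{Bern}(1/2)}_K(z)=\max_{S\subset\{1,\dots,n\},\ |S|=K,\ |S\cap\mathcal{PC}|=z}Z_S .$$ Overlap Gap Property: given $0<\zeta_{1,n}<\zeta_{2,n}<K$ and $r^2_n>r^1_n>0$, the model exhibits the Overlap Gap Property (OGP) with parameters $(\zeta_{1,n},\zeta_{2,n},r^1_n,r^2_n)$ if w.h.p. as $n\to\infty$: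 (1) there exist $A,A'\subset\{1,\dots,n\}$ with $|A|=|A'|=K$, $|A\cap\mathcal{PC}|\le\zeta_{1,n}<\zeta_{2,n}\le|A'\cap\mathcal{PC}|$ and $|E[A]|,|E[A']|\ge r^2_n$; (2) every $A\subset\{1,\dots,n\}$ with $|A|=K$ and $\zeta_{1,n}\le|A\cap\mathcal{PC}|\le\zeta_{2,n}$ satisfies $|E[A]|\le r^1_n$. (Here the thresholds $r^1_n,r^2_n$ are allowed to be random.) ''W.h.p.'' means with probability tending to $1$. *)

(* Defs.v *)
(* MathComp / MathComp-Analysis development. *)
From HB Require Import structures.
From mathcomp Require Import all_boot all_order all_algebra.
From mathcomp Require Import all_classical all_reals all_analysis.
Set Implicit Arguments.
Unset Strict Implicit.
Unset Printing Implicit Defensive.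
Import Order.TTheory GRing.Theory Num.Theory.
Import numFieldNormedType.Exports.
Local Open Scope classical_set_scope.
Local Open Scope ring_scope.

(* Vertices are numbered from 0: {1, ..., n} is 'I_n. *)
Definition vpair (n : nat) : finType := {e : 'I_n * 'I_n | (e.1 < e.2)%N}.

Definition inside (n : nat) (S : {set 'I_n}) (e : vpair n) : bool :=
  ((val e).1 \in S) && ((val e).2 \in S).

(* One fair coin per pair i < j. Under the uniform measure on this finite
   product the coins are i.i.d. with parameter 1/2. *)
Definition coins (n : nat) : finType := {ffun vpair n -> bool}.

Definition prob (R : realType) (n : nat) (E : set (coins n)) : R :=
  #|[pred w : coins n | `[< E w >]]|%:R / #|{: coins n}|%:R.

Definition whp (R : realType) (E : forall n : nat, set (coins n)) : Prop :=
  (fun n : nat => prob R (E n)) @ \oo --> (1 : R).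

Section Unplanted.
Context {R : realType}.

Definition rademacher (n : nat) (w : coins n) (e : vpair n) : R :=
  if w e then 1 else -1.

Definition ZR (n : nat) (w : coins n) (S : {set 'I_n}) : R :=
  \sum_(e : vpair n | inside S e) rademacher w e.

(* Extended reals are used only so that a maximum over no set is -oo; there is
   no such case when K <= n. *)
Definition PsiR (n K : nat) (w : coins n) : \bar R :=
  \big[maxe/-oo%E]_(S : {set 'I_n} | #|S| == K) (ZR w S)%:E.

Definition Lbound (n K : nat) : R :=
  Num.sqrt (2 * 'C(K, 2)%:R * ln ('C(n, K)%:R * K%:R^-1)).

(* Psi_K >= L(n,K) - o(K log n) w.h.p. *)
Definition unplanted_lower_bound (K : nat -> nat) : Prop :=
  forall eps : R, 0 < eps ->
    whp R (fun n => [set w : coins n |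
      ((Lbound n (K n) - eps * (K n)%:R * ln n%:R)%:E <= PsiR (K n) w)%E]).

End Unplanted.

Definition PC (n K : nat) : {set 'I_n} := finset (fun i : 'I_n => (i < K)%N).

(* The coins of the pairs inside PC are overridden by 1. *)
Definition planted_edge (n K : nat) (w : coins n) (e : vpair n) : bool :=
  inside (PC n K) e || w e.

Definition nedges (n K : nat) (w : coins n) (S : {set 'I_n}) : nat :=
  (\sum_(e : vpair n | inside S e) planted_edge K w e)%N.

Definition PsiBern (n K : nat) (w : coins n) (z : nat) : nat :=
  (\max_(S : {set 'I_n} | (#|S| == K) && (#|S :&: PC n K| == z))
     nedges K w S)%N.

(* The overlaps z for which PsiBern is considered: floor(K^2/n) <= z <= K. *)
Definition admissible_overlap (n K z : nat) : bool :=
  (K ^ 2 %/ n <= z <= K)%N.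

Section OverlapGap.
Context {R : realType}.

Definition maxPsiBern (n K : nat) (w : coins n) (a b : R) : nat :=
  (\max_(0 <= z < (Num.truncn b).+1 | (a <= z%:R <= b)%R) PsiBern K w z)%N.

Definition OGP (K : nat -> nat) (zeta1 zeta2 : nat -> R)
    (r1 r2 : forall n : nat, coins n -> R) : Prop :=
  [/\ \forall n \near \oo,
        0 < zeta1 n /\ zeta1 n < zeta2 n /\ zeta2 n < (K n)%:R,
      (* the thresholds are random, hence are ordered only w.h.p. *)
      whp R (fun n => [set w | 0 < r1 n w /\ r1 n w < r2 n w]) &
      whp R (fun n => [set w |
        (exists A A' : {set 'I_n},
           [/\ #|A| = K n, #|A'| = K n,
               #|A :&: PC n (K n)|%:R <= zeta1 n /\ zeta1 n < zeta2 n /\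
               zeta2 n <= #|A' :&: PC n (K n)|%:R,
               r2 n w <= (nedges (K n) w A)%:R &
               r2 n w <= (nedges (K n) w A')%:R]) /\
        (forall A : {set 'I_n}, #|A| = K n ->
           zeta1 n <= #|A :&: PC n (K n)|%:R ->
           #|A :&: PC n (K n)|%:R <= zeta2 n ->
           (nedges (K n) w A)%:R <= r1 n w)])].

(* K = floor(n^alpha) *)
Definition Kpow (alpha : R) (n : nat) : nat := Num.truncn (n%:R `^ alpha).

Definition zeta (D : R) (K : nat) : R := D * Num.sqrt (K%:R * ln K%:R).

(* floor(C0 K^2 / n) *)
Definition low_overlap (C0 : R) (n K : nat) : nat :=
  Num.truncn (C0 * K%:R ^+ 2 / n%:R).

Definition r2_thr (C0 : R) (K : nat -> nat) (n : nat) (w : coins n) : R :=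
  (minn (PsiBern (K n) w (low_overlap C0 n (K n)))
        (PsiBern (K n) w (K n %/ 2)))%:R.

Definition r1_thr (C0 C1 : R) (K : nat -> nat) (n : nat) (w : coins n) : R :=
  r2_thr C0 K w - C1 * (K n)%:R * ln (K n)%:R.

End OverlapGap.

(* Main.v *)
Require Import Defs.
From HB Require Import structures.
From mathcomp Require Import all_boot all_order all_algebra.
From mathcomp Require Import all_classical all_reals all_analysis.
From mathcomp Require Import zify ring lra.
Set Implicit Arguments.
Unset Strict Implicit.
Unset Printing Implicit Defensive.
Import Order.TTheory GRing.Theory Num.Theory.
Import numFieldNormedType.Exports.
Local Open Scope classical_set_scope.
Local Open Scope ring_scope.

(** Write N for the number of pairs in a K-set and ZR S for the sum of the signs
    of the pairs of S.  A K-set S meeting the clique in z vertices has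
    (N + ZR S) / 2 edges plus an excess of at most z^2 / 2 coming from the
    planted pairs, so the theorem compares maxima of ZR over different families
    of K-sets.

    Overlaps in the window.  Let m be about D sqrt(K ln K).  The K-sets meeting
    the clique in at least m vertices are fewer than all K-sets by a factor
    (e K^2 / (n m))^m ([overlap_count_le]).  Since alpha < 2/3, the quotient
    K^2 / (n m) is a negative power of n, so this factor is n^(-c m) with
    c = (1 - 3 alpha / 2) / 2.  The Chernoff bound together with a union bound
    ([prob_max_ZR]) then shows that on all these sets ZR is at most
    sqrt(2 N (ln 'C(n, K) - c m ln n + ln n)) with high probability.  As
    sqrt(2 N ln 'C(n, K)) is about K^(3/2) sqrt(ln n), the term c m ln n lowers
    this square root by a multiple of D K ln n.  The planted excess is at most
    2 D^2 K ln K for overlaps up to 2 D sqrt(K ln K), which is smaller once D is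
    a small multiple of c.

    Overlap z = 4 K^2 / n.  Let S be the union of z clique vertices and of an
    optimal set of size K - z of an unplanted graph on n' vertices outside the
    clique.  As floor(j^alpha) takes every value, n' can be chosen with
    floor(n'^alpha) = K - z, and 4 K^2 / n is large enough for n' + K <= n
    ([near_smaller_graph]).  The conjectured bound at n' gives ZR of the optimal
    set.  That set is independent of the coins between it and the z clique
    vertices, whose sum is therefore of order sqrt(z K) ([prob_cross]), and the
    pairs among the z vertices cost at most z^2.  All these errors, and the
    change from L(n, K) to L(n', K - z), are negligible because z is much
    smaller than sqrt(K) ([sqrt_gap], [near_gap]).

    Overlap K / 2.  One fixed set is enough: its planted pairs add about
    K^2 / 16 edges, which exceeds every other term ([whp_high]).

    Hence both outer maxima exceed the maximum over the window by a multiple of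
    K ln K, and the Overlap Gap Property is a rewording of that gap. *)

(** * Uniform coins, moments and concentration *)

Section Coins.
Context {R : realType}.

Definition mean (n : nat) (f : coins n -> R) : R :=
  (\sum_w f w) / #|{: coins n}|%:R.

Lemma card_coins_gt0 (n : nat) : (0 : R) < #|{: coins n}|%:R.
Proof. by rewrite ltr0n card_ffun card_bool expn_gt0. Qed.

Lemma ler_mean (n : nat) (f g : coins n -> R) :
  (forall w, f w <= g w) -> mean f <= mean g.
Proof. by move=> fg; rewrite ler_wpM2r ?invr_ge0 ?ler0n// ler_sum. Qed.

Lemma probE (n : nat) (E : set (coins n)) :
  prob R E = mean (fun w => `[< E w >]%:R).
Proof.
rewrite /prob /mean -sum1_card natr_sum/= big_mkcond/=; congr (_ / _).
by apply: eq_bigr => w _; rewrite inE; case: ifP.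
Qed.

(** Markov's inequality; every bad event below is bounded by the mean of an
    exponential or of a square. *)
Lemma prob_le_mean (n : nat) (E : set (coins n)) (f : coins n -> R) :
  (forall w, 0 <= f w) -> (forall w, E w -> 1 <= f w) -> prob R E <= mean f.
Proof.
move=> f0 f1; rewrite probE ler_mean// => w.
by case: asboolP => // /f1.
Qed.

Lemma prob_setC (n : nat) (E : set (coins n)) : prob R (~` E) = 1 - prob R E.
Proof.
rewrite !probE; apply: (mulIf (lt0r_neq0 (card_coins_gt0 n))).
rewrite mulrBl mul1r !divfK ?lt0r_neq0 ?card_coins_gt0//.
rewrite -sum1_card natr_sum -sumrB; apply: eq_bigr => w _.
by rewrite asbool_neg; case: asboolP => _ /=; ring.
Qed.

Lemma prob_ge0 (n : nat) (E : set (coins n)) : 0 <= prob R E.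
Proof. by rewrite /prob divr_ge0 ?ler0n. Qed.

Lemma le_prob (n : nat) (E F : set (coins n)) :
  E `<=` F -> prob R E <= prob R F.
Proof.
move=> EF; rewrite !probE; apply: ler_mean => w; case: asboolP => // /EF Fw.
by rewrite asboolT.
Qed.

Lemma prob_le1 (n : nat) (E : set (coins n)) : prob R E <= 1.
Proof. by have := prob_ge0 (~` E); rewrite prob_setC subr_ge0. Qed.

Lemma le_probU (n : nat) (E F G : set (coins n)) :
  G `<=` E `|` F -> prob R G <= prob R E + prob R F.
Proof.
move=> GEF; rewrite !probE /mean -mulrDl -big_split; apply: ler_mean => w /=.
case: (asboolP (G w)) => [/GEF[Ew|Fw]|_] /=; last by rewrite addr_ge0.
- by rewrite (asboolT Ew) lerDl.
- by rewrite (asboolT Fw) lerDr.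
Qed.

Lemma whp_small (E : forall n, set (coins n)) (b : nat -> R) :
  (\forall n \near \oo, prob R (~` E n) <= b n) ->
  (b n @[n --> \oo] --> (0 : R)) -> whp R E.
Proof.
move=> Eb b0; rewrite /whp.
apply: (@squeeze_cvgr _ \oo _ _ (fun n => 1 - b n) (fun=> 1)).
- near=> n; rewrite prob_le1 andbT lerBlDr -lerBlDl -prob_setC.
  by near: n.
- have : 1 - b n @[n --> \oo] --> (1 - 0 : R) by apply: cvgB => //; exact: cvg_cst.
  by rewrite subr0.
- exact: cvg_cst.
Unshelve. all: by end_near. Qed.

Lemma whp_setC (E : forall n, set (coins n)) :
  whp R E -> prob R (~` E n) @[n --> \oo] --> (0 : R).
Proof.
move=> E1; under eq_fun do rewrite prob_setC.
have : 1 - prob R (E n) @[n --> \oo] --> (1 - 1 : R) by apply: cvgB => //; exact: cvg_cst.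
by rewrite subrr.
Qed.

Lemma whpI (E F : forall n, set (coins n)) :
  whp R E -> whp R F -> whp R (fun n => E n `&` F n).
Proof.
move=> /whp_setC E0 /whp_setC F0.
apply: (whp_small (b := fun n => prob R (~` E n) + prob R (~` F n))).
  by apply: nearW => n; apply: le_probU; rewrite setCI.
have : prob R (~` E n) + prob R (~` F n) @[n --> \oo] --> (0 + 0 : R) by exact: cvgD.
by rewrite addr0.
Qed.

Lemma whpS (E G : forall n, set (coins n)) : whp R E ->
  (\forall n \near \oo, E n `<=` G n) -> whp R G.
Proof.
move=> /whp_setC E0 EG; apply: whp_small E0.
by near=> n; apply/le_prob/subsetC; near: n.
Unshelve. all: by end_near. Qed.

Lemma nondecreasing_from0 (f df : R -> R) (x : R) :
  (forall y : R, is_derive y 1 f (df y)) -> (forall y, 0 <= y -> 0 <= df y) ->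
  0 <= x -> f 0 <= f x.
Proof.
move=> fdf df0 x0; have fd (y : R) : derivable f y 1 by case: (fdf y).
apply: (@ger0_derive1_ndecry _ f 0) => //.
  move=> y; rewrite in_itv/= andbT => /ltW y0.
  by rewrite derive1E; have [_ ->] := fdf y; exact: df0.
apply: continuous_subspaceT => y; apply: differentiable_continuous.
exact/derivable1_diffP.
Qed.

(** The factor 1/2 in the exponent is sharp, and the leading terms of the two
    compared thresholds agree only because of it.  The quotient of the two sides
    decreases on x >= 0 since sinh x <= x cosh x there. *)
Lemma cosh_le (x : R) : expR x + expR (- x) <= 2 * expR (x ^+ 2 / 2).
Proof.
pose c (x : R) := expR x + expR (- x).
pose s (x : R) := expR x - expR (- x).
have dc (y : R) : is_derive y 1 c (s y).
  by apply: is_derive_eq; rewrite mulrN1.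
have ds (y : R) : is_derive y 1 s (c y).
  by apply: is_derive_eq; rewrite mulrN1 opprK.
wlog x0 : x / 0 <= x => [hw|].
  have [|/ltW xN] := lerP 0 x; first exact: hw.
  by have := hw (- x); rewrite opprK sqrrN addrC; apply; rewrite oppr_ge0.
have s_le (y : R) : 0 <= y -> 0 <= y * c y - s y.
  move=> y0; have -> : 0 = 0 * c 0 - s 0 :> R by rewrite /s oppr0 subrr mul0r subr0.
  apply: (@nondecreasing_from0 (fun y => y * c y - s y) (fun y => y * s y)) => //.
    by move=> z; apply: is_derive_eq; rewrite /GRing.scale/=; ring.
  by move=> z z0; rewrite mulr_ge0// subr_ge0 ler_expR; lra.
have : - (c 0 * expR (- (0 ^+ 2 / 2))) <= - (c x * expR (- (x ^+ 2 / 2))).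
  apply: (@nondecreasing_from0 (fun y => - (c y * expR (- (y ^+ 2 / 2))))
    (fun y => (y * c y - s y) * expR (- (y ^+ 2 / 2)))) => //.
    by move=> z; apply: is_derive_eq; rewrite /GRing.scale/=; field.
  by move=> z z0; rewrite mulr_ge0 ?expR_ge0// s_le.
rewrite lerN2 expRN ler_pdivrMr ?expR_gt0// => /le_trans; apply.
by rewrite ler_wpM2r ?expR_ge0// /c expr0n/= mul0r !oppr0 expR0 mulr1.
Qed.

(** The exponential of a sum over pairs is a product of functions of single
    coins, so that its sum over all outcomes factors. *)
Lemma mgf_rademacher (n : nat) (P : pred (vpair n)) (l : R) :
  mean (fun w => expR (l * \sum_(e | P e) rademacher w e)) <=
  expR (l ^+ 2 / 2 * #|P|%:R).
Proof.
rewrite /mean ler_pdivrMr ?card_coins_gt0//.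
pose F (e : vpair n) (b : bool) : R :=
  if P e then expR (l * (if b then 1 else -1)) else 1.
have -> : \sum_w expR (l * \sum_(e | P e) rademacher w e)
   = \prod_(e : vpair n) \sum_(b : bool) F e b.
  rewrite bigA_distr_bigA; apply: eq_bigr => w _.
  rewrite mulr_sumr expR_sum big_mkcond/=; apply: eq_bigr => e _.
  by rewrite /F /rademacher.
have -> : expR (l ^+ 2 / 2 * #|P|%:R) =
    \prod_(e : vpair n) (if P e then expR (l ^+ 2 / 2) else 1).
  by rewrite -big_mkcond/= prodr_const -expRM_natr.
have -> : #|{: coins n}|%:R = \prod_(e : vpair n) (2 : R).
  by rewrite card_ffun card_bool natrX prodr_const.
rewrite -big_split/=; apply: ler_prod => e _.
rewrite big_bool /F; case: ifP => _; last by rewrite mul1r lexx andbT addr_ge0.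
by rewrite addr_ge0 ?expR_ge0//= mulr1 mulrN1 [leRHS]mulrC cosh_le.
Qed.

Definition flip (n : nat) (e : vpair n) (w : coins n) : coins n :=
  [ffun e' => if e' == e then ~~ w e' else w e'].

Lemma flipK (n : nat) (e : vpair n) : involutive (flip e).
Proof. by move=> w; apply/ffunP => e'; rewrite !ffunE; case: eqP => // _; rewrite negbK. Qed.

(** Orthogonality of distinct coins, for a set of coins that may itself be
    random: if A w ignores the coins that it contains, flipping e in A w keeps
    A w and changes the sign of every mixed product in which e occurs. *)
Lemma second_moment (n : nat) (A : coins n -> {set vpair n}) :
  (forall w e, e \in A w -> A (flip e w) = A w) ->
  mean (fun w => (\sum_(e in A w) rademacher w e) ^+ 2) =
  mean (fun w => #|A w|%:R).
Proof.
move=> Aflip; congr (_ / _).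
pose a w e : R := if e \in A w then rademacher w e else 0.
have aN w e : a (flip e w) e = - a w e.
  have -> : a (flip e w) e = if e \in A w then rademacher (flip e w) e else 0.
    rewrite /a; case: ifPn => [e1|e1].
      by have /= := Aflip _ _ e1; rewrite flipK => ->; rewrite e1.
    by case: ifPn => // e2; move: e1; rewrite Aflip// e2.
  by rewrite /a /rademacher ffunE eqxx; case: ifP; case: (w e); rewrite ?oppr0 ?opprK.
have aE w e e' : e' != e -> a w e != 0 -> a (flip e w) e' = a w e'.
  move=> ee'; rewrite /a; case: ifPn => [e1 _|]; last by rewrite eqxx.
  by rewrite (Aflip _ _ e1) /rademacher ffunE (negbTE ee').
transitivity (\sum_w \sum_e \sum_e' a w e * a w e').
  apply: eq_bigr => w _; rewrite expr2 big_mkcond/= mulr_suml.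
  by apply: eq_bigr => e _; rewrite mulr_sumr.
rewrite exchange_big; under eq_bigr do rewrite exchange_big/=.
rewrite [RHS](_ : _ = \sum_w \sum_e (a w e) ^+ 2); last first.
  apply: eq_bigr => w _; rewrite -sum1_card natr_sum big_mkcond/=.
  apply: eq_bigr => e _; rewrite /a /rademacher.
  by case: ifP; case: (w e) => _ //=; ring.
rewrite [RHS]exchange_big/=; apply: eq_bigr => e _.
rewrite (bigD1 e)//= [X in _ + X]big1 ?addr0 => [|e' ee'].
  by apply: eq_bigr => w _; rewrite expr2.
set S := \sum_w _; suff : S = - S by lra.
rewrite {1}/S (reindex_inj (inv_inj (flipK e)))/= -sumrN.
apply: eq_bigr => w _; rewrite aN mulNr.
have [->|a0] := eqVneq (a w e) 0; first by rewrite !mul0r.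
by rewrite aE.
Qed.

End Coins.

(** * Pairs inside a set, edge counts and the union bound *)

Section Sets.
Context {R : realType}.

Lemma card_inside (n : nat) (S : {set 'I_n}) :
  #|[pred e : vpair n | inside S e]| = 'C(#|S|, 2).
Proof.
pose f (e : vpair n) : {set 'I_n} := [set (val e).1; (val e).2]%SET.
have f_inj : injective f.
  move=> e e' /setP ee; apply/val_inj; move: (valP e) (valP e').
  have := (ee (val e).1, ee (val e).2, ee (val e').1, ee (val e').2).
  rewrite !inE !eqxx ?orbT; case: (val e) (val e') => [x y] [x' y'] /= [[[]]].
  by move=> /esym/orP[]/eqP-> /esym/orP[]/eqP-> _ _ // lt1 lt2;
    first [by rewrite ltnn in lt1 | by have := ltn_trans lt1 lt2; rewrite ltnn].
rewrite -cards_draws -(card_imset _ f_inj).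
apply: eq_card => A; rewrite !inE; apply/imsetP/andP.
  move=> [e]; rewrite inE => /andP[e1 e2] ->; split.
    by rewrite finset.subUset !finset.sub1set e1.
  by rewrite cards2 neq_ltn (valP e).
move=> [AS /cards2P[x [y [xy AE]]]].
wlog ltxy : x y xy AE / (x < y)%N => [hw|].
  have [ltxy|yx|/val_inj/eqP] := ltngtP x y; [exact: (hw x y)| |by rewrite (negbTE xy)].
  by apply: (hw y x) => //; [rewrite eq_sym | rewrite finset.setUC].
exists (exist (fun e : 'I_n * 'I_n => (e.1 < e.2)%N) (x, y) ltxy) => //; rewrite inE.
by move: AS; rewrite AE finset.subUset !finset.sub1set.
Qed.

Lemma inside_setI (n : nat) (S T : {set 'I_n}) (e : vpair n) :
  inside (S :&: T) e = inside S e && inside T e.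
Proof. by rewrite /inside !inE andbACA. Qed.

Lemma sum_inside1 (n : nat) (S : {set 'I_n}) :
  \sum_(e : vpair n | inside S e) 1 = 'C(#|S|, 2)%:R :> R.
Proof. by rewrite -card_inside -sum1_card natr_sum; apply: eq_bigl => e; rewrite inE. Qed.

(** A planted pair counts 1 = (1 + r) / 2 + (1 - r) / 2, where r is the sign of
    its coin; the second half is the excess due to the clique. *)
Lemma nedgesE (n K : nat) (w : coins n) (S : {set 'I_n}) :
  (nedges K w S)%:R = ('C(#|S|, 2)%:R + ZR w S
    + \sum_(e : vpair n | inside (S :&: PC n K) e) (1 - rademacher w e)) / 2 :> R.
Proof.
rewrite /nedges natr_sum -sum_inside1 /ZR -big_split/=.
under [X in _ + X]eq_bigl do rewrite inside_setI.
rewrite [X in _ + X]big_mkcondr -big_split/= mulr_suml; apply: eq_bigr => e _.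
by rewrite /planted_edge /rademacher; case: (inside (PC n K) e); case: (w e) => /=; field.
Qed.

Lemma rademacher_bounds (n : nat) (w : coins n) (e : vpair n) :
  -1 <= (rademacher w e : R) <= 1.
Proof. by rewrite /rademacher; case: (w e); apply/andP; split; lra. Qed.

Lemma nedges_ge (n K : nat) (w : coins n) (S : {set 'I_n}) :
  ('C(#|S|, 2)%:R + ZR w S) / 2 <= (nedges K w S)%:R :> R.
Proof.
rewrite nedgesE ler_wpM2r ?invr_ge0 ?ler0n// lerDl sumr_ge0// => e _.
by have := rademacher_bounds w e; lra.
Qed.

Lemma nedges_le (n K : nat) (w : coins n) (S : {set 'I_n}) :
  (nedges K w S)%:R <= ('C(#|S|, 2)%:R + ZR w S) / 2 + 'C(#|S :&: PC n K|, 2)%:R :> R.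
Proof.
rewrite nedgesE mulrDl lerD2l -sum_inside1 mulr_suml ler_sum// => e _.
by have := rademacher_bounds w e; lra.
Qed.

Lemma nedges_planted (n K : nat) (w : coins n) (S : {set 'I_n}) :
  (nedges K w S)%:R = ('C(#|S|, 2)%:R + 'C(#|S :&: PC n K|, 2)%:R
    + \sum_(e : vpair n | inside S e && ~~ inside (PC n K) e) rademacher w e) / 2 :> R.
Proof.
rewrite nedgesE -!sum_inside1 sumrB; congr (_ / 2).
rewrite /ZR (bigID (fun e => inside (PC n K) e) (fun e => inside S e) (rademacher w))/=.
under [X in _ = _ + X + _]eq_bigl do rewrite inside_setI.
under [X in _ + (_ - X) = _]eq_bigl do rewrite inside_setI.
under [X in _ + (X - _) = _]eq_bigl do rewrite inside_setI.
ring.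
Qed.

(** Such a set is given by m of its vertices in P and by its other K - m
    vertices; sets with a larger overlap are counted several times. *)
Lemma card_overlap_le (n K m : nat) (P : {set 'I_n}) : (m <= K)%N ->
  (#|[set S : {set 'I_n} | (#|S| == K) && (m <= #|S :&: P|)%N]%SET|
    <= 'C(#|P|, m) * 'C(n - m, K - m))%N.
Proof.
move=> mK; pose D := [set Q : {set 'I_n} | (Q \subset P) && (#|Q| == m)]%SET.
pose sup (Q : {set 'I_n}) := [set S : {set 'I_n} | (#|S| == K) && (Q \subset S)]%SET.
apply: (@leq_trans #|(\bigcup_(Q in D) sup Q)%SET|).
  apply: subset_leq_card; apply/fintype.subsetP => S; rewrite inE => /andP[SK mS].
  have : (0 < #|[set Q : {set 'I_n} | Q \subset S :&: P & #|Q| == m]|)%N.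
    by rewrite cards_draws bin_gt0.
  case/card_gt0P => Q; rewrite inE finset.subsetI => /andP[/andP[QS QP] Qm].
  by apply/finset.bigcupP; exists Q; rewrite inE ?QP// SK.
rewrite -cards_draws -sum_nat_const.
apply: (@leq_trans (\sum_(Q in D) #|sup Q|)%N).
  elim/big_rec2 : _ => [|Q b A _ Ab]; first by rewrite cards0.
  by rewrite (leq_trans (leq_card_setU _ _))// leq_add2l.
apply: leq_sum => Q; rewrite inE => /andP[_ /eqP Qm].
have -> : (n - m)%N = #|~: Q| by rewrite cardsCs finset.setCK card_ord Qm.
rewrite -cards_draws.
apply: leq_trans (leq_imset_card (fun U => Q :|: U) _).
apply: subset_leq_card; apply/fintype.subsetP => S; rewrite inE => /andP[/eqP SK QS].
apply/imsetP; exists (S :\: Q).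
  by rewrite inE finset.subsetDr/= cardsD (finset.setIidPr QS) SK Qm.
by apply/setP => x; rewrite !inE; case: (x \in Q) (fintype.subsetP QS x) => //= ->.
Qed.

(** Chernoff's bound with the optimal parameter U / N, summed over F. *)
Lemma prob_max_ZR (n K : nat) (F : {set {set 'I_n}}) (U : R) :
  (1 < K)%N -> 0 <= U -> (forall S, S \in F -> #|S| = K) ->
  prob R [set w : coins n | exists2 S : {set 'I_n}, S \in F & U < ZR w S] <=
  #|F|%:R * expR (- (U ^+ 2 / (2 * 'C(K, 2)%:R))).
Proof.
move=> K1 U0 FK; set N : R := 'C(K, 2)%:R.
have N0 : 0 < N by rewrite ltr0n bin_gt0.
pose l := U / N.
apply: (le_trans (prob_le_mean (f := fun w => \sum_(S in F) expR (l * (ZR w S - U))) _ _)).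
- by move=> w; rewrite sumr_ge0// => S _; rewrite expR_ge0.
- move=> w [S SF US]; rewrite (bigD1 S)//=.
  have rest : 0 <= \sum_(i in F | i != S) expR (l * (ZR w i - U)).
    by rewrite sumr_ge0// => ? _; rewrite expR_ge0.
  rewrite -[leLHS]addr0 lerD// -expR0 ler_expR mulr_ge0 ?subr_ge0 ?(ltW US)//.
  by rewrite divr_ge0// ltW.
rewrite /mean exchange_big/= mulr_suml mulr_natl -[leRHS]sumr_const.
apply: ler_sum => S SF.
have -> : \sum_w expR (l * (ZR w S - U)) = expR (- (l * U)) * \sum_w expR (l * ZR w S).
  by rewrite mulr_sumr; apply: eq_bigr => w _; rewrite -expRD; congr expR; ring.
rewrite -mulrA.
have := @mgf_rademacher R n (inside S) l; rewrite /mean => mS.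
have {mS} := ler_wpM2l (expR_ge0 (- (l * U))) mS.
move/le_trans; apply; rewrite -expRD ler_expR.
have -> : #|inside S| = 'C(K, 2) by rewrite -(FK _ SF) -card_inside; apply: eq_card.
rewrite -/N /l le_eqVlt; apply/orP; left; apply/eqP.
by field; rewrite lt0r_neq0.
Qed.

End Sets.

(** * A smaller graph outside the clique *)

Section Transfer.
Context {R : realType}.

Definition restr (n' n : nat) (f : vpair n' -> vpair n) (w : coins n) : coins n' :=
  [ffun e => w (f e)].

(** The translations of the small coin space lift to translations of the large
    one.  Averaging over all of them replaces the restriction of a fixed w by a
    uniform element of the small space. *)
Lemma mean_restr (n' n : nat) (f : vpair n' -> vpair n) (g : coins n' -> R) :
  injective f -> mean (fun w => g (restr f w)) = mean g.
Proof.
move=> f_inj; apply: (mulIf (lt0r_neq0 (card_coins_gt0 n))).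
rewrite divfK ?lt0r_neq0 ?card_coins_gt0//.
apply: (mulIf (lt0r_neq0 (card_coins_gt0 n'))).
rewrite mulrAC divfK ?lt0r_neq0 ?card_coins_gt0//.
(* ext v is v extended by false outside the image of f *)
pose ext (v : coins n') (e : vpair n) : bool :=
  if [pick e' | f e' == e] is Some e' then v e' else false.
pose shift v (w : coins n) : coins n := [ffun e => w e (+) ext v e].
have shiftK v : involutive (shift v).
  by move=> w; apply/ffunP => e; rewrite !ffunE addbK.
pose xor (v u : coins n') : coins n' := [ffun e => u e (+) v e].
have restr_shift v w : restr f (shift v w) = xor v (restr f w).
  apply/ffunP => e; rewrite !ffunE /ext.
  by case: pickP => [e' /eqP/f_inj->//|/(_ e)]; rewrite eqxx.
have sum_shift v : \sum_w g (restr f w) = \sum_w g (xor v (restr f w)).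
  rewrite (reindex_inj (inv_inj (shiftK v)))/=.
  by apply: eq_bigr => w _; rewrite restr_shift.
rewrite mulr_natr -sumr_const/= (eq_bigr _ (fun v _ => sum_shift v)).
rewrite exchange_big/= mulr_natr -[RHS]sumr_const; apply: eq_bigr => w _.
have xorK : involutive (fun v => xor v (restr f w)).
  by move=> v; apply/ffunP => e; rewrite !ffunE; case: (w (f e)); case: (v e).
by rewrite [RHS](reindex_inj (inv_inj xorK)).
Qed.

Lemma prob_restr (n' n : nat) (f : vpair n' -> vpair n) (E : set (coins n')) :
  injective f -> prob R [set w | E (restr f w)] = prob R E.
Proof. by move=> f_inj; rewrite !probE -(mean_restr _ f_inj). Qed.

Section Shift.
Variables (K n' n : nat) (le_n : (K + n' <= n)%N).

(** The n' vertices of the smaller graph are placed right after the K vertices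
    of the clique. *)
Definition shift_ord (i : 'I_n') : 'I_n :=
  widen_ord le_n (rshift K i).

Lemma shift_ord_inj : injective shift_ord.
Proof. by move=> i j /(congr1 val)/= /addnI/val_inj. Qed.

Lemma shift_pair_subproof (e : vpair n') :
  (shift_ord (val e).1 < shift_ord (val e).2)%N.
Proof. by rewrite /= ltn_add2l (valP e). Qed.

Definition shift_pair (e : vpair n') : vpair n :=
  exist (fun e : 'I_n * 'I_n => (e.1 < e.2)%N)
    (shift_ord (val e).1, shift_ord (val e).2) (shift_pair_subproof e).

Lemma shift_pair_inj : injective shift_pair.
Proof.
move=> e e' /(congr1 val) [/addnI/val_inj h1 /addnI/val_inj h2]; apply/val_inj.
by rewrite [LHS]surjective_pairing h1 h2 -surjective_pairing.
Qed.

Lemma inside_shift (S : {set 'I_n'}) (e : vpair n) :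
  inside (shift_ord @: S) e = (e \in [set shift_pair e' | e' in inside S]%SET).
Proof.
apply/andP/imsetP => [[/imsetP[i iS ei] /imsetP[j jS ej]]|[e' /andP[e1 e2] ->]].
  have ij : (i < j)%N by have := valP e; rewrite /= ei ej/= ltn_add2l.
  exists (exist (fun e : 'I_n' * 'I_n' => (e.1 < e.2)%N) (i, j) ij).
    by rewrite unfold_in /inside /= iS.
  by apply/val_inj; rewrite /= -ei -ej -surjective_pairing.
by split; exact: imset_f.
Qed.

Lemma ZR_shift (w : coins n) (S : {set 'I_n'}) :
  ZR w (shift_ord @: S) = ZR (restr shift_pair w) S :> R.
Proof.
rewrite /ZR (eq_bigl _ _ (inside_shift S)) big_imset/=; last first.
  by move=> e e' _ _; exact: shift_pair_inj.
by apply: eq_bigr => e _; rewrite /rademacher ffunE.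
Qed.

End Shift.

(** For disjoint T and S, the pairs with one end in each. *)
Definition cross (n : nat) (T S : {set 'I_n}) : {set vpair n} :=
  [set e | inside (T :|: S) e && ~~ inside T e && ~~ inside S e]%SET.

Lemma sum_insideU (n : nat) (T S : {set 'I_n}) (g : vpair n -> R) :
  fintype.disjoint (mem T) (mem S) ->
  \sum_(e | inside (T :|: S) e) g e = \sum_(e | inside T e) g e
    + \sum_(e | inside S e) g e + \sum_(e in cross T S) g e.
Proof.
move=> dTS; rewrite (bigID (inside T))/= -addrA; congr (_ + _).
  apply: eq_bigl => e; rewrite /inside !inE.
  by case: (_ \in T); case: (_ \in T); rewrite ?andbF.
rewrite (bigID (inside S))/=; congr (_ + _).
  apply: eq_bigl => e; rewrite /inside !inE.
  have := disjointFl dTS; move=> dis.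
  case e1: ((\val e).1 \in S); case e2: ((\val e).2 \in S); rewrite ?andbF//=.
  by rewrite (dis _ e1) (dis _ e2).
by apply: eq_bigl => e; rewrite inE.
Qed.

Lemma bin2D (a b : nat) : ('C(a + b, 2) = 'C(a, 2) + 'C(b, 2) + a * b)%N.
Proof.
elim: b => [|b IH]; first by rewrite !addn0 muln0 addn0.
by rewrite addnS !binS !bin1 IH; lia.
Qed.

Lemma card_cross (n : nat) (T S : {set 'I_n}) :
  fintype.disjoint (mem T) (mem S) -> #|cross T S| = (#|T| * #|S|)%N.
Proof.
move=> dTS; have := sum_insideU (fun=> 1) dTS; rewrite !sum_inside1.
rewrite (_ : #|T :|: S| = #|T| + #|S|)%N; last first.
  by apply/eqP; rewrite (leq_card_setU T S).2.
rewrite sumr_const -[1 *+ _]/(_%:R) -!natrD => /eqP; rewrite eqr_nat => /eqP.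
by rewrite bin2D => /addnI.
Qed.

Lemma ZR_ge (n : nat) (w : coins n) (S : {set 'I_n}) :
  - 'C(#|S|, 2)%:R <= ZR w S :> R.
Proof.
rewrite -sum_inside1 -sumrN ler_sum// => e _.
by have := @rademacher_bounds R _ w e; lra.
Qed.

(** The set s may depend on the coins as long as it does not see the crossing
    ones: flipping one of those then leaves it unchanged, and the crossing sum
    has the variance of a sum of independent signs. *)
Lemma prob_cross (K n' n : nat) (le_n : (K + n' <= n)%N) (T : {set 'I_n})
    (s : coins n' -> {set 'I_n'}) (k : nat) (t : R) :
  T \subset PC n K -> (forall u, (#|s u| <= k)%N) -> 0 < t ->
  prob R [set w | \sum_(e in cross T (shift_ord le_n @: s (restr (shift_pair le_n) w)))
     rademacher w e < - t] <= (#|T| * k)%:R / t ^+ 2.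
Proof.
move=> TPC sk t0; pose A w := cross T (shift_ord le_n @: s (restr (shift_pair le_n) w)).
have dT (U : {set 'I_n'}) : fintype.disjoint (mem T) (mem (shift_ord le_n @: U)).
  apply/pred0P => x /=; apply/negP => /andP[/(fintype.subsetP TPC)].
  by rewrite inE => xK /imsetP[i _ xE]; move: xK; rewrite xE /= ltnNge leq_addr.
have Aflip w e : e \in A w -> A (flip e w) = A w.
  move=> eA; rewrite /A; congr (cross _ (_ @: s _)); apply/ffunP => e'.
  rewrite !ffunE; case: eqP => // ee'; move: eA; rewrite -ee' /A inE.
  move=> /andP[/andP[]]; rewrite {1}/inside !finset.in_setU => /andP[].
  (* a pair of the smaller graph has no end in T, hence cannot be a crossing one *)
  have nT i : (shift_ord le_n i \in T) = false.
    by apply/negP => /(fintype.subsetP TPC); rewrite inE /= ltnNge leq_addr.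
  rewrite /= !nT/= => i1 i2 _; rewrite /inside i1 i2//.
apply: (le_trans (prob_le_mean (f := fun w =>
   (\sum_(e in A w) rademacher w e) ^+ 2 / t ^+ 2) _ _)).
- by move=> w; rewrite divr_ge0 ?sqr_ge0.
- move=> w /= wt; rewrite ler_pdivlMr ?exprn_gt0// mul1r -[leRHS]sqrrN.
  by rewrite lerXn2r ?nnegrE; lra.
have -> : mean (fun w => (\sum_(e in A w) rademacher w e) ^+ 2 / t ^+ 2) =
   mean (fun w => (\sum_(e in A w) rademacher w e) ^+ 2) / t ^+ 2.
  by rewrite /mean -mulr_suml mulrAC.
rewrite ler_wpM2r ?invr_ge0 ?sqr_ge0// second_moment//.
rewrite /mean ler_pdivrMr ?card_coins_gt0// mulr_natr -sumr_const.
apply: ler_sum => w _; rewrite ler_nat card_cross// leq_mul2l.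
by rewrite card_imset ?sk ?orbT//; exact: shift_ord_inj.
Qed.

End Transfer.

(** * Sets with a prescribed overlap *)

Section Existence.
Context {R : realType}.

Lemma card_PC (n K : nat) : (K <= n)%N -> #|PC n K| = K.
Proof.
move=> Kn; rewrite -sum1_card (eq_bigl (fun i : 'I_n => (i < K)%N)).
  by rewrite (big_ord_narrow Kn) sum1_card card_ord.
by move=> i; rewrite inE.
Qed.

Section Glue.
Variables (K n' n : nat) (le_n : (K + n' <= n)%N) (T : {set 'I_n}) (U : {set 'I_n'}).
Hypothesis TPC : T \subset PC n K.

Lemma shift_notin_PC (i : 'I_n') : shift_ord le_n i \notin PC n K.
Proof. by rewrite inE /= -leqNgt leq_addr. Qed.

Lemma disjoint_shift : fintype.disjoint (mem T) (mem (shift_ord le_n @: U)).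
Proof.
apply/pred0P => x /=; apply/negP => /andP[/(fintype.subsetP TPC) xPC].
by move=> /imsetP[i _ xE]; move: xPC; rewrite xE (negbTE (shift_notin_PC i)).
Qed.

Lemma card_glue : #|T :|: shift_ord le_n @: U| = (#|T| + #|U|)%N.
Proof.
rewrite -(card_imset (mem U) (@shift_ord_inj K n' n le_n)).
by apply/eqP; rewrite (leq_card_setU _ _).2 disjoint_shift.
Qed.

Lemma glue_overlap : (T :|: shift_ord le_n @: U) :&: PC n K = T.
Proof.
rewrite finset.setIUl (finset.setIidPl TPC).
suff -> : shift_ord le_n @: U :&: PC n K = finset.set0 by rewrite finset.setU0.
apply/setP => x; rewrite !inE; apply/negP => /andP[/imsetP[i _ ->]].
by have := shift_notin_PC i; rewrite inE => /negP.
Qed.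

End Glue.

(** The set is the union of the first z vertices and of a set of size k chosen
    in the graph on the n' vertices after the clique.  The term a is what that
    graph provides, t bounds the crossing coins, and the last binomial is the
    worst case for the pairs among the first z vertices. *)
Lemma prob_low_overlap (K n' n z k : nat) (a t : R) :
  (K + n' <= n)%N -> (z <= K)%N -> 0 < t ->
  prob R [set w : coins n | ~ exists S : {set 'I_n},
    [/\ #|S| = (z + k)%N, #|S :&: PC n K| = z & a - t - 'C(z, 2)%:R <= ZR w S]]
  <= prob R [set u : coins n' | ~ exists2 S : {set 'I_n'}, #|S| = k & a <= ZR u S]
     + (z * k)%:R / t ^+ 2.
Proof.
move=> le_n zK t0.
have zn : (z <= n)%N by rewrite (leq_trans zK)// (leq_trans _ le_n)// leq_addr.
(* some good set, or the empty set if there is none, so that #|s u| <= k *)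
pose s (u : coins n') : {set 'I_n'} :=
  if [pick V : {set 'I_n'} | (#|V| == k) && (a <= ZR u V)] is Some V then V
  else finset.set0.
have sk u : (#|s u| <= k)%N.
  by rewrite /s; case: pickP => [S /andP[/eqP->]|]//; rewrite cards0.
have TPC : PC n z \subset PC n K.
  by apply/fintype.subsetP => i; rewrite !inE => /leq_trans; apply.
have := prob_cross le_n TPC sk t0; rewrite card_PC// => Pcross.
rewrite -(prob_restr _ (@shift_pair_inj K n' n le_n)).
apply: (le_trans _ (lerD (lexx _) Pcross)).
apply: le_probU => w /= noS; apply: contrapT => /not_orP[/= /contrapT [S0 S0k S0a]].
move=> /negP; rewrite -leNgt => cross_ge; apply: noS.
move: (erefl (s (restr (shift_pair le_n) w))).
rewrite {2}/s; case: pickP => [S /andP[/eqP Sk Sa] sE|]; last first.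
  by move=> /(_ S0); rewrite S0k eqxx S0a.
rewrite sE in cross_ge.
exists (PC n z :|: shift_ord le_n @: S); split.
- by rewrite card_glue// card_PC// Sk.
- by rewrite glue_overlap// card_PC.
rewrite /ZR sum_insideU ?disjoint_shift//.
rewrite -/(ZR w (PC n z)) -/(ZR w (shift_ord le_n @: S)) ZR_shift.
have := @ZR_ge R _ w (PC n z); rewrite card_PC//; lra.
Qed.

(** One fixed set of overlap h: its planted pairs contribute deterministically
    and the others are controlled by Chebyshev's inequality. *)
Lemma prob_high_overlap (K n h : nat) (t : R) :
  (h <= K)%N -> (K + (K - h) <= n)%N -> 0 < t ->
  prob R [set w : coins n | ~ exists S : {set 'I_n},
    [/\ #|S| = K, #|S :&: PC n K| = h &
        ('C(K, 2)%:R + 'C(h, 2)%:R - t) / 2 <= (nedges K w S)%:R :> R]]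
  <= 'C(K, 2)%:R / t ^+ 2.
Proof.
move=> hK le_n t0.
have Kn : (K <= n)%N by rewrite (leq_trans _ le_n)// leq_addr.
have hn : (h <= n)%N by rewrite (leq_trans hK).
have TPC : PC n h \subset PC n K.
  by apply/fintype.subsetP => i; rewrite !inE => /leq_trans; apply.
pose S := PC n h :|: shift_ord le_n @: [set: 'I_(K - h)]%SET.
have SK : #|S| = K by rewrite card_glue// card_PC// cardsT card_ord subnKC.
have Sh : #|S :&: PC n K| = h by rewrite glue_overlap// card_PC.
pose A := [set e : vpair n | inside S e && ~~ inside (PC n K) e]%SET.
apply: (le_trans (prob_le_mean (f := fun w =>
   (\sum_(e in A) rademacher w e) ^+ 2 / t ^+ 2) _ _)).
- by move=> w; rewrite divr_ge0 ?sqr_ge0.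
- move=> w /= noS; rewrite ler_pdivlMr ?exprn_gt0// mul1r -[leRHS]sqrrN.
  have [tA|tA] := lerP t (- \sum_(e in A) rademacher w e).
    by rewrite lerXn2r ?nnegrE//; lra.
  exfalso; apply: noS; exists S; split => //.
  rewrite nedges_planted SK Sh ler_wpM2r ?invr_ge0//.
  rewrite (eq_bigl (fun e => e \in A)); last by move=> e; rewrite inE.
  by rewrite lerD2l -lerN2 opprK ltW.
rewrite [leLHS](_ : _ =
   mean (fun w => (\sum_(e in A) rademacher w e : R) ^+ 2) / t ^+ 2); last first.
  by rewrite /mean -mulr_suml mulrAC.
rewrite ler_wpM2r ?invr_ge0 ?sqr_ge0//.
rewrite (second_moment (A := fun=> A))// /mean ler_pdivrMr ?card_coins_gt0//.
rewrite sumr_const mulr_natr ler_wMn2r// ler_nat -SK -card_inside.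
by apply: subset_leq_card; apply/fintype.subsetP => e; rewrite !inE => /andP[].
Qed.

Lemma PsiR_attained (n k : nat) (w : coins n) (a : R) :
  (a%:E <= PsiR k w)%E -> exists2 S : {set 'I_n}, #|S| = k & a <= ZR w S.
Proof.
rewrite /PsiR; elim/big_ind : _ => [|x y IHx IHy|S /eqP Sk].
- by rewrite leeNy_eq.
- by rewrite le_max => /orP[/IHx|/IHy].
- by rewrite lee_fin; exists S.
Qed.

End Existence.

(** * Binomial estimates *)

Section Binomials.
Context {R : realType}.

Lemma bin_mul (n K m : nat) : (m <= K)%N -> (K <= n)%N ->
  ('C(n, K) * 'C(K, m) = 'C(n, m) * 'C(n - m, K - m))%N.
Proof.
move=> mK Kn; have mn := leq_trans mK Kn.
have [h1 h2] := (bin_fact Kn, bin_fact mK).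
have [h3 h4] := (bin_fact mn, bin_fact (leq_sub2r m Kn)).
rewrite subnBA// subnK// in h4.
apply/eqP; rewrite -(@eqn_pmul2r (m`! * (K - m)`! * (n - K)`!)) ?muln_gt0 ?fact_gt0//.
apply/eqP; transitivity n`!.
  by rewrite -h1 -h2; ring.
by rewrite -h3 -h4; ring.
Qed.

Lemma ffact_ratio_le (K n m : nat) : (K <= n)%N -> (K ^_ m * n ^ m <= K ^ m * n ^_ m)%N.
Proof.
move=> Kn; elim: m => // m IH; rewrite !ffactnSr !expnSr.
have -> : (K ^_ m * (K - m) * (n ^ m * n) = (K ^_ m * n ^ m) * ((K - m) * n))%N by ring.
have -> : (K ^ m * K * (n ^_ m * (n - m)) = (K ^ m * n ^_ m) * (K * (n - m)))%N by ring.
by rewrite leq_mul//; nia.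
Qed.

Lemma ffact_le_exp (K m : nat) : (K ^_ m <= K ^ m)%N.
Proof. by elim: m => // m IH; rewrite ffactnSr expnSr leq_mul// leq_subr. Qed.

(** The term of order m of the exponential series at m. *)
Lemma exp_le_fact (m : nat) : m%:R ^+ m <= m`!%:R * expR 1 ^+ m :> R.
Proof.
case: m => [|m]; first by rewrite !expr0 fact0 mulr1.
have := @expR_ge1Dxn R m.+1%:R m (ler0n _ _).
move=> h; rewrite -expRM_natl mulr1 mulrC -ler_pdivrMr ?ltr0n ?fact_gt0//.
by apply: le_trans h; rewrite lerDr.
Qed.

(** After dividing by 'C(n, K), this is a tail bound for the hypergeometric
    distribution of mean K^2 / n.  The bound m! >= (m / e)^m has to be used
    rather than (m / 2)^(m / 2), which would put sqrt(m) in place of m: when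
    alpha is close to 2/3, K^2 / (n sqrt(m)) is not small. *)
Lemma overlap_count_le (n K m : nat) : (0 < m)%N -> (m <= K)%N -> (K <= n)%N ->
  ('C(K, m) * 'C(n - m, K - m))%:R <=
    'C(n, K)%:R * (expR 1 * K%:R ^+ 2 / (n%:R * m%:R)) ^+ m :> R.
Proof.
move=> m0 mK Kn; have mn := leq_trans mK Kn.
have n0 : (0 < n)%N by exact: leq_trans mn.
have Cnm0 : (0 : R) < 'C(n, m)%:R by rewrite ltr0n bin_gt0.
have key : ('C(K, m) ^ 2)%:R <=
    'C(n, m)%:R * (expR 1 * K%:R ^+ 2 / (n%:R * m%:R)) ^+ m :> R.
  have f0 : (0 : R) < m`!%:R by rewrite ltr0n fact_gt0.
  rewrite -(ler_pM2r (exprn_gt0 2 f0)).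
  have -> : ('C(K, m) ^ 2)%:R * m`!%:R ^+ 2 = (K ^_ m)%:R * (K ^_ m)%:R :> R.
    by rewrite -natrX -!natrM -bin_ffact; congr _%:R; ring.
  have -> : 'C(n, m)%:R * (expR 1 * K%:R ^+ 2 / (n%:R * m%:R)) ^+ m * m`!%:R ^+ 2
    = (K%:R ^+ m * (n ^_ m)%:R / n%:R ^+ m) * (K%:R ^+ m * (m`!%:R * expR 1 ^+ m / m%:R ^+ m)) :> R.
    rewrite -bin_ffact natrM !exprMn exprVn exprMn.
    by field; rewrite !expf_neq0// pnatr_eq0 -lt0n.
  apply: ler_pM => //.
    rewrite ler_pdivlMr ?exprn_gt0 ?ltr0n// -!natrX -!natrM ler_nat.
    exact: ffact_ratio_le.
  apply: (@le_trans _ _ (K%:R ^+ m)); first by rewrite -natrX ler_nat ffact_le_exp.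
  rewrite ler_peMr ?exprn_ge0// ler_pdivlMr ?exprn_gt0 ?ltr0n// mul1r.
  exact: exp_le_fact.
(* 'C(n, m) 'C(n - m, K - m) = 'C(n, K) 'C(K, m): choose the m-set first or last *)
rewrite -(ler_pM2l Cnm0).
have -> : 'C(n, m)%:R * ('C(K, m) * 'C(n - m, K - m))%:R
   = 'C(n, K)%:R * ('C(K, m) ^ 2)%:R :> R.
  rewrite -!natrM; congr _%:R.
  by rewrite mulnCA -bin_mul//; ring.
by rewrite mulrCA ler_wpM2l.
Qed.

Lemma bin_shift_le (n k z : nat) : ('C(n, z + k) <= n ^ z * 'C(n, k))%N.
Proof.
elim: z => [|z IH]; first by rewrite mul1n.
apply: (@leq_trans (n * 'C(n, z + k))); last by rewrite expnS -mulnA leq_mul2l IH orbT.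
rewrite addSn; have := mul_bin_left n (z + k).
apply: contra_eqT; rewrite -ltnNge => h; rewrite neq_ltn; apply/orP; right.
apply: (@leq_ltn_trans (n * 'C(n, z + k))); first by rewrite leq_mul2r leq_subr orbT.
by apply: (leq_trans h); rewrite mulSn leq_addr.
Qed.

Lemma bin_ratio_le (n n' k : nat) : (k < n')%N -> (n' <= n)%N ->
  'C(n, k)%:R <= 'C(n', k)%:R * (1 + (n - n')%:R / (n' - k)%:R) ^+ k :> R.
Proof.
move=> kn' n'n.
have f0 : (0 : R) < k`!%:R by rewrite ltr0n fact_gt0.
rewrite -(ler_pM2r f0) mulrAC -!natrM !bin_ffact.
have d0 : (0 : R) < (n' - k)%:R by rewrite ltr0n subn_gt0.
suff H j : (j <= k)%N -> (n ^_ j)%:R <= (n' ^_ j)%:R * (1 + (n - n')%:R / (n' - k)%:R) ^+ j :> R.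
  exact: H.
elim: j => [|j IH] jk; first by rewrite !ffactn0 mulr1.
rewrite !ffactnSr !natrM exprSr mulrACA ler_pM// ?IH 1?ltnW//.
rewrite mulrDr mulr1 -lerBlDl mulrA ler_pdivlMr//.
rewrite -natrB; last by rewrite leq_sub2r.
rewrite -!natrM ler_nat; nia.
Qed.

(** Passing from K-sets of n vertices to k-sets of n' vertices costs about
    ln n for each removed element, plus the effect of the ratio n / n'. *)
Lemma ln_bin_le (n k z n' : nat) : (k < n')%N -> (n' <= n)%N -> (z + k <= n)%N ->
  ln ('C(n, z + k)%:R : R) <= ln ('C(n', k)%:R : R) + z%:R * ln n%:R
    + k%:R * ((n - n')%:R / (n' - k)%:R).
Proof.
move=> kn' n'n zkn.
have n0 : (0 : R) < n%:R by rewrite ltr0n; lia.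
have C0 : (0 : R) < 'C(n, z + k)%:R by rewrite ltr0n bin_gt0.
have C'0 : (0 : R) < 'C(n', k)%:R by rewrite ltr0n bin_gt0 ltnW.
have h := bin_shift_le n k z.
have {}h : 'C(n, z + k)%:R <= n%:R ^+ z * 'C(n, k)%:R :> R.
  by rewrite -natrX -natrM ler_nat.
set d := _ / _.
have {}h : 'C(n, z + k)%:R <= n%:R ^+ z * ('C(n', k)%:R * expR (k%:R * d)) :> R.
  apply: (le_trans h); rewrite ler_wpM2l ?exprn_ge0//.
  apply: (le_trans (bin_ratio_le kn' n'n)); rewrite ler_wpM2l// expRM_natl.
  by rewrite lerXn2r ?nnegrE ?expR_ge0 ?expR_ge1Dx// addr_ge0// divr_ge0.
rewrite -ler_ln ?posrE// in h; last by rewrite !mulr_gt0 ?exprn_gt0 ?expR_gt0.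
apply: (le_trans h).
rewrite !lnM ?posrE ?mulr_gt0 ?exprn_gt0 ?expR_gt0// expRK lnXn// -mulr_natl.
lra.
Qed.

Lemma ln_bin_le_mul (n k : nat) : (k <= n)%N -> ln ('C(n, k)%:R : R) <= k%:R * ln n%:R.
Proof.
case: n => [|n] kn; first by move: kn; rewrite leqn0 => /eqP->; rewrite bin0 ln1 mul0r.
have := bin_shift_le n.+1 0 k; rewrite addn0 bin0 muln1 => h.
rewrite mulr_natl -lnXn// ler_ln ?posrE ?exprn_gt0 ?ltr0n ?bin_gt0//.
by rewrite -natrX ler_nat.
Qed.

Lemma bin2E (a : nat) : 'C(a, 2)%:R = a%:R * (a%:R - 1) / 2 :> R.
Proof.
elim: a => [|a IH]; first by rewrite bin0n mul0r mul0r.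
by rewrite binS bin1 natrD IH -natr1; field.
Qed.

Lemma half_ge (k : nat) : k%:R - 1 <= 2 * (k %/ 2)%:R :> R.
Proof. by rewrite -natrM lerBlDr natr1 ler_nat; lia. Qed.

Lemma bin2_le_sqr (k : nat) (x : R) : k%:R * k%:R <= x -> 'C(k, 2)%:R <= x.
Proof.
apply: le_trans; rewrite bin2E -mulrA ler_wpM2l//.
by have : 0 <= k%:R :> R by []; lra.
Qed.

Lemma half_bin_ge (k : nat) : 8 <= k%:R :> R ->
  k%:R ^+ 2 / 16 <= 'C(k %/ 2, 2)%:R :> R.
Proof.
have := half_ge k; rewrite bin2E.
by move: (k%:R : R) ((k %/ 2)%:R : R) => x h hx x8; nra.
Qed.

End Binomials.

(** * Growth of K and of the low overlap *)

Section Asymptotics.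
Context {R : realType}.

Lemma near_powR_ge (g C : R) : 0 < g -> \forall n \near \oo, C <= n%:R `^ g.
Proof.
move=> g0; pose c := Num.max C 1.
have c0 : 0 < c by rewrite lt_max ltr01 orbT.
near=> n; apply: (@le_trans _ _ c); first by rewrite le_max lexx.
have cn : c `^ g^-1 <= n%:R by near: n; exact: nbhs_infty_ger.
have := ge0_ler_powR (ltW g0); move=> /(_ (c `^ g^-1) n%:R).
rewrite !nnegrE powR_ge0 ler0n => /(_ isT isT cn).
by rewrite -powRrM mulVf ?gt_eqF// powRr1// ltW.
Unshelve. all: by end_near. Qed.

Lemma near_ln_le_powR (g C : R) : 0 < g -> 0 <= C ->
  \forall n \near \oo, C * ln n%:R <= n%:R `^ g.
Proof.
move=> g0 C0; have g20 : 0 < g / 2 by rewrite divr_gt0.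
near=> n; have n0 : 0 < n%:R :> R by rewrite ltr0n; near: n; exact: (nbhs_infty_gt 0).
have h1 : C * (2 / g) <= n%:R `^ (g / 2) by near: n; exact: (near_powR_ge _ g20).
have h2 : g / 2 * ln n%:R <= n%:R `^ (g / 2).
  by rewrite -ln_powR; apply/ltW/ln_sublinear; rewrite powR_gt0.
have -> : n%:R `^ g = n%:R `^ (g / 2) * n%:R `^ (g / 2).
  rewrite -powRD; last by rewrite (gt_eqF n0) implybT.
  by congr (_ `^ _); lra.
apply: le_trans (ler_pM _ _ h1 h2).
- by rewrite le_eqVlt; apply/orP; left; apply/eqP; field; rewrite gt_eqF.
- by rewrite mulr_ge0// divr_ge0// ltW.
- by rewrite mulr_ge0 ?(ltW g20)// ln_ge0// ler1n -(ltr0n R).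
Unshelve. all: by end_near. Qed.

Lemma near_ln_ge (C : R) : \forall n \near \oo, C <= ln n%:R.
Proof.
near=> n; rewrite -[C]expRK ler_ln ?posrE ?expR_gt0//.
  by near: n; exact: nbhs_infty_ger.
by rewrite ltr0n; near: n; exact: (nbhs_infty_gt 0).
Unshelve. all: by end_near. Qed.

Lemma cvg_invr_ln : (ln n%:R)^-1 @[n --> \oo] --> (0 : R).
Proof.
apply/cvgrPdist_le => e e0; near=> n.
have h : e^-1 <= ln n%:R by near: n; exact: near_ln_ge.
have l0 : 0 < ln n%:R :> R by apply: lt_le_trans h; rewrite invr_gt0.
rewrite sub0r normrN ger0_norm ?invr_ge0 ?(ltW l0)//.
by rewrite -[leRHS]invrK lef_pV2 ?posrE ?invr_gt0.
Unshelve. all: by end_near. Qed.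

Section Kpow.
Variable alpha : R.
Hypotheses (alpha_ge : 1 / 2 <= alpha) (alpha_lt : alpha < 2 / 3).
Notation K := (Kpow alpha).
Notation k n := ((Kpow alpha n)%:R : R).
Notation x n := (n%:R `^ alpha : R).
Let beta : R := 1 - 3 / 2 * alpha.

Let alpha0 : 0 < alpha. Proof. by have := alpha_ge; lra. Qed.
Let beta0 : 0 < beta. Proof. by rewrite /beta; move: alpha_lt; lra. Qed.

Lemma Kpow_itv (n : nat) : k n <= x n < k n + 1.
Proof. by have := truncn_itv (powR_ge0 n%:R alpha); rewrite -natr1. Qed.

Lemma near_Kpow_ge (C : R) : \forall n \near \oo, C <= k n.
Proof.
near=> n; have /andP[_] := Kpow_itv n.
have : C + 1 <= x n by near: n; exact: near_powR_ge.
by lra.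
Unshelve. all: by end_near. Qed.

Lemma near_half_powR_le_Kpow : \forall n \near \oo, x n / 2 <= k n.
Proof.
near=> n; have /andP[_] := Kpow_itv n.
have : 2 <= x n by near: n; exact: near_powR_ge.
by lra.
Unshelve. all: by end_near. Qed.

Lemma near_ln_le_Kpow (C : R) : 0 <= C -> \forall n \near \oo, C * ln n%:R <= k n.
Proof.
move=> C0; near=> n.
have h : x n / 2 <= k n by near: n; exact: near_half_powR_le_Kpow.
have : (2 * C) * ln n%:R <= x n by near: n; apply: near_ln_le_powR; rewrite ?mulr_ge0.
by lra.
Unshelve. all: by end_near. Qed.

(** This is where alpha < 2/3 is used: K^(3/2) is at most n^(1 - beta) with
    beta > 0, which leaves room for half of that power. *)
Lemma near_Kpow_sqrt_le (C : R) : 0 <= C ->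
  \forall n \near \oo, C * (k n * Num.sqrt (k n)) * n%:R `^ (beta / 2) <= n%:R.
Proof.
move=> C0; near=> n.
have n0 : 0 < n%:R :> R by rewrite ltr0n; near: n; exact: (nbhs_infty_gt 0).
have /andP[kx _] := Kpow_itv n.
have h : C <= n%:R `^ (beta / 2) by near: n; apply: near_powR_ge; rewrite divr_gt0.
have nD (a b : R) : n%:R `^ (a + b) = n%:R `^ a * n%:R `^ b :> R.
  by rewrite powRD// (gt_eqF n0) implybT.
have sx : Num.sqrt (k n) <= n%:R `^ (alpha / 2).
  by rewrite powRrM powR12_sqrt ?powR_ge0// ler_wsqrtr.
rewrite [leRHS](_ : _ =
    n%:R `^ (beta / 2) * (x n * n%:R `^ (alpha / 2)) * n%:R `^ (beta / 2)); last first.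
  by rewrite -!nD -[LHS]powRr1//; congr (_ `^ _); rewrite /beta; lra.
rewrite ler_wpM2r ?powR_ge0// ler_pM ?mulr_ge0 ?sqrtr_ge0//.
by rewrite ler_pM ?sqrtr_ge0.
Unshelve. all: by end_near. Qed.

Lemma near_Kpow_sq_le (C : R) : 0 <= C ->
  \forall n \near \oo, C * (k n) ^+ 2 / n%:R <= Num.sqrt (k n).
Proof.
move=> C0; near=> n.
have n0 : 0 < n%:R :> R by rewrite ltr0n; near: n; exact: (nbhs_infty_gt 0).
have h : C * (k n * Num.sqrt (k n)) * n%:R `^ (beta / 2) <= n%:R.
  by near: n; exact: near_Kpow_sqrt_le.
have h1 : 1 <= n%:R `^ (beta / 2) :> R by near: n; apply: near_powR_ge; rewrite divr_gt0.
have {h1}h : C * (k n * Num.sqrt (k n)) <= n%:R.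
  by apply: le_trans h; rewrite ler_peMr// !mulr_ge0 ?sqrtr_ge0.
have := ler_wpM2r (sqrtr_ge0 (k n)) h; rewrite ler_pdivrMr//.
have := sqr_sqrtr (ler0n R (K n)); set s := Num.sqrt _ => sE.
by rewrite -mulrA -mulrA -expr2 sE -expr2 [_ * s]mulrC.
Unshelve. all: by end_near. Qed.

Lemma near_Kpow_le_id (C : R) : 0 <= C -> \forall n \near \oo, C * k n <= n%:R.
Proof.
move=> C0; near=> n.
have k1 : 1 <= k n by near: n; exact: near_Kpow_ge.
have h : C * (k n * Num.sqrt (k n)) * n%:R `^ (beta / 2) <= n%:R.
  by near: n; exact: near_Kpow_sqrt_le.
have h1 : 1 <= n%:R `^ (beta / 2) :> R by near: n; apply: near_powR_ge; rewrite divr_gt0.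
have s1 : 1 <= Num.sqrt (k n) by rewrite -[leLHS]sqrtr1 ler_wsqrtr.
apply: le_trans h; rewrite -[leLHS]mulr1 ler_pM ?mulr_ge0//.
by rewrite ler_wpM2l// ler_peMr.
Unshelve. all: by end_near. Qed.

Lemma near_ln_le_ln_Kpow : \forall n \near \oo, ln n%:R <= 4 * ln (k n).
Proof.
near=> n.
have n0 : 0 < n%:R :> R by rewrite ltr0n; near: n; exact: (nbhs_infty_gt 0).
have h : x n / 2 <= k n by near: n; exact: near_half_powR_le_Kpow.
have l2 : 4 * ln 2 <= ln n%:R :> R by near: n; exact: near_ln_ge.
have x0 : 0 < x n / 2 by rewrite divr_gt0// powR_gt0.
have : ln (x n / 2) <= ln (k n) by rewrite ler_ln ?posrE// (lt_le_trans x0).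
rewrite ln_div ?posrE ?powR_gt0// ln_powR.
have : 1 / 2 * ln n%:R <= alpha * ln n%:R by rewrite ler_wpM2r// ln_ge0// ler1n -(ltr0n R).
by lra.
Unshelve. all: by end_near. Qed.

Notation z n := (low_overlap (4 : R) n (Kpow alpha n)).

Lemma low_overlap_itv (n : nat) : (z n)%:R <= 4 * k n ^+ 2 / n%:R < (z n)%:R + 1.
Proof.
have : 0 <= 4 * k n ^+ 2 / n%:R :> R by rewrite divr_ge0 ?mulr_ge0 ?sqr_ge0.
by move=> /truncn_itv; rewrite -/(low_overlap 4 n (K n)) -[(z n).+1%:R]natr1.
Qed.

(** The factor 4 absorbs both roundings, of n^alpha to K and of 4 K^2 / n to an
    integer.  The lower bound n^(2 alpha - 1) is what the smaller graph needs to
    fit outside the clique, and alpha >= 1/2 makes it at least 1. *)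
Lemma near_low_overlap_ge : \forall n \near \oo,
  1 <= x n ^+ 2 / n%:R <= (z n)%:R.
Proof.
near=> n.
have n0 : 0 < n%:R :> R by rewrite ltr0n; near: n; exact: (nbhs_infty_gt 0).
have /andP[_ kx] := Kpow_itv n.
have x4 : 4 <= x n by near: n; exact: near_powR_ge.
have x1 : 1 <= x n ^+ 2 / n%:R.
  rewrite ler_pdivlMr// mul1r -powR_mulrn ?powR_ge0// -powRrM.
  by rewrite le1r_powR ?ler1n -?(ltr0n R)//; move: alpha_ge; lra.
rewrite x1/=; have /andP[_] := low_overlap_itv n.
have : 2 * (x n ^+ 2 / n%:R) <= 4 * k n ^+ 2 / n%:R.
  by rewrite mulrA ler_wpM2r ?invr_ge0//; nra.
by lra.
Unshelve. all: by end_near. Qed.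

Lemma near_low_overlap_le (C : R) : 0 <= C ->
  \forall n \near \oo, C * (1 + (z n)%:R) <= Num.sqrt (k n).
Proof.
move=> C0; near=> n.
have /andP[x1 xz] : 1 <= x n ^+ 2 / n%:R <= (z n)%:R by near: n; exact: near_low_overlap_ge.
have /andP[zk _] := low_overlap_itv n.
have h : (8 * C) * (k n) ^+ 2 / n%:R <= Num.sqrt (k n).
  by near: n; apply: near_Kpow_sq_le; rewrite mulr_ge0.
apply: le_trans h.
have -> : 8 * C * k n ^+ 2 / n%:R = C * (2 * (4 * k n ^+ 2 / n%:R)).
  by rewrite !mulrA; congr (_ * _ / _); ring.
by rewrite ler_wpM2l//; lra.
Unshelve. all: by end_near. Qed.

(** The floor of j^alpha skips no value because (j + 1)^alpha <= j^alpha + 1. *)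
Lemma Kpow_onto (j : nat) : (0 < j)%N ->
  exists n', Kpow alpha n' = j /\ forall i : nat, j%:R <= x i -> (n' <= i)%N.
Proof.
move=> j0.
have ex : exists i : nat, j%:R <= x i.
  have [i _ /(_ i (leqnn i))] := near_powR_ge j%:R alpha0.
  by exists i.
case: (ex_minnP ex) => -[|i] jx imin.
  by move: jx; rewrite powR0 ?gt_eqF// lern0 -leqn0 leqNgt j0.
exists i.+1; split; last exact: imin.
apply: truncn_def; rewrite jx/= -[j.+1%:R]natr1.
have xi : x i < j%:R by rewrite ltNge; apply/negP => /imin; rewrite ltnn.
apply: (@le_lt_trans _ _ (x i + 1)); last by rewrite ltrD2r.
case: i {jx imin xi} => [|i]; first by rewrite powR1 powR0 ?gt_eqF// add0r.
have i0 : 0 < i.+1%:R :> R by rewrite ltr0n.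
have -> : i.+2%:R = i.+1%:R * (1 + i.+1%:R^-1) :> R.
  by rewrite mulrDr mulr1 mulfV ?gt_eqF// natr1.
rewrite powRM ?addr_ge0 ?invr_ge0//.
apply: (@le_trans _ _ (x i.+1 * (1 + i.+1%:R^-1))).
  by rewrite ler_wpM2l ?powR_ge0// ler1_powR ?lerDl ?invr_ge0//; have := alpha_lt; lra.
rewrite mulrDr mulr1 lerD2l ler_pdivrMr// mul1r ler1_powR ?ler1n//.
by have := alpha_lt; lra.
Qed.

End Kpow.
End Asymptotics.

(** * Size of the smaller graph *)

Section SmallerGraph.
Context {R : realType}.

(** With x = n^alpha and z >= x^2 / n, the power (n - K)^alpha is at least
    x (1 - K / n), hence at least K - z, so that the minimal n' is at most n - K.
    Conversely n'^alpha >= K - z forces n' / n to be at least 1 - 2 u with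
    u = (1 + z) / x. *)
Lemma near_smaller_graph (alpha : R) : 1 / 2 <= alpha -> alpha < 2 / 3 ->
  \forall n \near \oo, forall n' k' : nat,
  k' = (Kpow alpha n - low_overlap (4 : R) n (Kpow alpha n))%N ->
  Kpow alpha n' = k' -> (forall i : nat, k'%:R <= i%:R `^ alpha -> (n' <= i)%N) ->
  [/\ (Kpow alpha n + n' <= n)%N, (k' < n')%N &
      k'%:R * ((n - n')%:R / (n' - k')%:R) <=
        4 * (1 + (low_overlap (4 : R) n (Kpow alpha n))%:R) :> R].
Proof.
move=> alpha_ge alpha_lt; near=> n => n' k' k'E.
have n0 : 0 < n%:R :> R by rewrite ltr0n; near: n; exact: (nbhs_infty_gt 0).
have k1 : 1 <= (Kpow alpha n)%:R :> R by near: n; exact: near_Kpow_ge.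
have k4n : 4 * (Kpow alpha n)%:R <= n%:R :> R by near: n; exact: near_Kpow_le_id.
have zs : 16 * (1 + (low_overlap (4 : R) n (Kpow alpha n))%:R)
    <= Num.sqrt (Kpow alpha n)%:R :> R by near: n; exact: near_low_overlap_le.
have /andP[x1 xz] : 1 <= (n%:R `^ alpha) ^+ 2 / n%:R <=
    ((low_overlap (4 : R) n (Kpow alpha n))%:R : R).
  by near: n; exact: near_low_overlap_ge.
have /andP[kx xk] := Kpow_itv alpha n.
move: k'E k1 k4n zs x1 xz kx xk.
set K := Kpow alpha n; set z := low_overlap _ _ _.
move=> {k'}-> k1 k4n zs x1 xz kx xk Kn' n'min.
set x := n%:R `^ alpha in x1 xz kx xk.
have s1 : 1 <= Num.sqrt K%:R :> R by rewrite -[leLHS]sqrtr1 ler_wsqrtr.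
have sk : Num.sqrt K%:R <= K%:R :> R.
  by rewrite -[leRHS](sqr_sqrtr (ler0n _ _)) expr2 ler_peMr.
have x0 : 0 < x by apply: lt_le_trans kx; clear -k1; lra.
have zK : (z <= K)%N.
  by rewrite -(ler_nat R); have : 0 <= z%:R :> R by []; clear -zs sk; lra.
have KzE : (K - z)%:R = K%:R - z%:R :> R by rewrite natrB.
have Kn : (K <= n)%N by rewrite -(ler_nat R); clear -k1 k4n; lra.
have n'n : (n' <= n - K)%N.
  apply: n'min; rewrite KzE.
  have -> : (n - K)%:R = n%:R * (1 - K%:R / n%:R) :> R.
    by rewrite natrB// mulrBr mulr1 mulrCA divff ?gt_eqF// mulr1.
  have kn1 : K%:R / n%:R <= 1 / 4 :> R by rewrite ler_pdivrMr//; clear -k4n; lra.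
  have kn0 : 0 <= K%:R / n%:R :> R by rewrite divr_ge0.
  rewrite powRM//; last by clear -kn1; lra.
  apply: (@le_trans _ _ (x * (1 - K%:R / n%:R))).
    have : x * (K%:R / n%:R) <= x ^+ 2 / n%:R.
      by rewrite expr2 -mulrA ler_wpM2l ?(ltW x0)// ler_wpM2r ?invr_ge0.
    by clear -xz kx; lra.
  rewrite ler_wpM2l ?(ltW x0)// ger1_powR//; last by clear -alpha_lt; lra.
  by clear -kn0 kn1; apply/andP; split; lra.
have n'n1 : (n' <= n)%N by rewrite (leq_trans n'n)// leq_subr.
pose u : R := (1 + z%:R) / x; pose r : R := n'%:R / n%:R.
have u0 : 0 <= u by rewrite divr_ge0 ?addr_ge0// ltW.
have u1 : u <= 1 / 16 by rewrite ler_pdivrMr//; clear -zs sk kx; lra.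
have r_ge : 1 - u <= r `^ alpha.
  have /andP[+ _] := Kpow_itv alpha n'; rewrite Kn' KzE.
  have -> : n'%:R = n%:R * r :> R by rewrite mulrCA divff ?gt_eqF// mulr1.
  rewrite powRM ?divr_ge0// -/x => h.
  rewrite -(ler_pM2l x0); apply: le_trans h.
  rewrite mulrBr mulr1 /u [x * _]mulrC divfK ?gt_eqF//.
  by clear -xk; lra.
have r0 : 0 < r.
  by apply: (gt0_powR (x := alpha)); [clear -alpha_ge; lra|rewrite divr_ge0|clear -r_ge u1; lra].
have r1 : r <= 1 by rewrite ler_pdivrMr// mul1r ler_nat.
(* since 2 alpha >= 1 and r <= 1, squaring r^alpha gives at most r *)
have r_ge2 : 1 - 2 * u <= r.
  apply: (@le_trans _ _ ((r `^ alpha) ^+ 2)).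
    apply: (@le_trans _ _ ((1 - u) ^+ 2)); last by rewrite lerXn2r ?nnegrE//; clear -r_ge u1; lra.
    by have -> : (1 - u) ^+ 2 = 1 - 2 * u + u ^+ 2; [ring | rewrite lerDl sqr_ge0].
  rewrite -powR_mulrn ?powR_ge0// -powRrM ge1r_powR ?r0//.
  by clear -alpha_ge; lra.
have n'E : n'%:R = n%:R * r :> R by rewrite mulrCA divff ?gt_eqF// mulr1.
have hn' : n%:R * (1 - 2 * u) <= n'%:R by rewrite n'E ler_wpM2l.
have nu : n%:R * u <= n%:R * (1 / 16) by rewrite ler_wpM2l.
have kz0 : (K - z)%:R <= K%:R :> R by rewrite ler_nat leq_subr.
have kz1 : (K - z)%:R < n'%:R :> R by clear -kz0 hn' nu k4n n0; lra.
have kn' : (K - z < n')%N by rewrite -(ltr_nat R).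
split=> //; first by rewrite -leq_subRL.
have d2 : n%:R / 2 <= (n' - (K - z))%:R :> R.
  by rewrite natrB 1?ltnW//; clear -kz0 hn' nu k4n n0; lra.
have ku : K%:R * u <= 1 + z%:R by rewrite mulrCA ler_piMr ?addr_ge0// ler_pdivrMr// mul1r.
have -> : 4 * (1 + z%:R) = (1 + z%:R) * (2 * (n%:R / (n%:R / 2))) :> R.
  by field; rewrite gt_eqF.
apply: (@le_trans _ _ (K%:R * (2 * n%:R * u / (n%:R / 2)))).
  rewrite ler_pM ?divr_ge0// ler_pM ?invr_ge0//.
    by rewrite natrB//; clear -hn'; lra.
  by rewrite lef_pV2 ?posrE ?ltr0n ?subn_gt0// divr_gt0.
have -> : K%:R *
    (2 * n%:R * u / (n%:R / 2)) = (K%:R * u) * (2 * (n%:R / (n%:R / 2))) :> R.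
  by field; rewrite gt_eqF.
by rewrite ler_wpM2r// mulr_ge0// divr_ge0 ?divr_ge0.
Unshelve. all: by end_near. Qed.

End SmallerGraph.

(** * The gap between the two thresholds *)

Section Compare.
Context {R : realType}.

(** Here s and q stand for the square roots of K and of ln n.  The squares of
    the two square roots differ by at least N c m q^2, since the errors, which
    are of order K^2 (1 + z) ln n, are absorbed by c m >= 32 (1 + z).  Both roots
    are of order s^3 q, so that the roots themselves differ by a multiple of
    D s^2 q^2. *)
Lemma sqrt_gap (s q N N' l l' lk z m c D : R) :
  0 <= s -> 1 <= q -> 0 <= z -> 0 <= N' -> N' <= N -> 0 < c -> 0 < D ->
  s ^+ 4 / 4 <= N -> N <= s ^+ 4 / 2 -> N - N' <= s ^+ 2 * z ->
  l <= s ^+ 2 * q ^+ 2 -> c * m * q ^+ 2 <= l ->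
  l <= l' + z * q ^+ 2 + 4 * (1 + z) -> lk <= q ^+ 2 ->
  32 * (1 + z) <= c * m -> D * (s * q) <= 4 * m ->
  c * D / 48 * q <= s ->
  Num.sqrt (2 * N * (l - c * m * q ^+ 2 + q ^+ 2)) + c * D / 48 * (s ^+ 2 * q ^+ 2)
    <= Num.sqrt (2 * N' * (l' - lk)).
Proof.
move=> s0 q1 z0 N'0 N'N c0 D0 Nge Nle NN' lle lge ll' lkq zm Dm kqs.
set K := c * D / 48; set U := Num.sqrt _; set g := K * _.
have q0 : 0 <= q by lra.
have qq1 : 1 <= q ^+ 2 by rewrite expr2 mulr_ege1.
have K0 : 0 <= K by rewrite !mulr_ge0 ?invr_ge0// ltW.
have cm0 : 1 <= c * m by lra.
have Q0 : 0 <= l - c * m * q ^+ 2 + q ^+ 2 by lra.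
have N0 : 0 <= N by lra.
have U0 : 0 <= U by rewrite sqrtr_ge0.
have g0 : 0 <= g by exact: mulr_ge0 K0 (mulr_ge0 (exprn_ge0 2 s0) (exprn_ge0 2 q0)).
have UE : U ^+ 2 = 2 * N * (l - c * m * q ^+ 2 + q ^+ 2).
  by rewrite sqr_sqrtr// !mulr_ge0.
have Ule : U <= s ^+ 3 * q.
  have t0 : 0 <= s ^+ 3 * q by rewrite mulr_ge0 ?exprn_ge0.
  rewrite -[leRHS]ger0_norm// -sqrtr_sqr ler_wsqrtr//.
  have h1 : l - c * m * q ^+ 2 + q ^+ 2 <= s ^+ 2 * q ^+ 2.
    have : 1 * q ^+ 2 <= c * m * q ^+ 2 by rewrite ler_wpM2r// exprn_ge0.
    by lra.
  apply: (@le_trans _ _ (s ^+ 4 * (s ^+ 2 * q ^+ 2))).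
    by rewrite ler_pM ?mulr_ge0//; lra.
  by rewrite le_eqVlt; apply/orP; left; apply/eqP; ring.
have Ug : 2 * U * g + g ^+ 2 <= N * (c * m) * q ^+ 2.
  have h1 : 2 * U * g <= 2 * (s ^+ 3 * q) * g by rewrite ler_wpM2r// ler_wpM2l.
  have h2 : g ^+ 2 <= (s ^+ 3 * q) * g.
    rewrite expr2 ler_wpM2r// /g.
    have := ler_wpM2r (mulr_ge0 (exprn_ge0 2 s0) q0) kqs.
    by rewrite -/K => /le_trans-/(_ (s ^+ 3 * q)) h; rewrite (le_trans _ (h _))//; nra.
  have h3 : s ^+ 4 / 4 * (c * (D * (s * q) / 4)) * q ^+ 2 <= N * (c * m) * q ^+ 2.
    rewrite ler_wpM2r ?exprn_ge0// ler_pM//.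
    - by rewrite divr_ge0// exprn_ge0.
    - by rewrite !mulr_ge0 ?invr_ge0// ltW.
    - by rewrite ler_wpM2l ?(ltW c0)//; lra.
  apply: le_trans h3.
  have -> : s ^+ 4 / 4 * (c * (D * (s * q) / 4)) * q ^+ 2 = 3 * (s ^+ 3 * q) * g.
    by rewrite /g /K; field.
  lra.
have err : 2 * N * l - 2 * N' * (l' - lk) <= 7 * s ^+ 4 * (1 + z) * q ^+ 2.
  have l0 : 0 <= l by apply: le_trans lge; rewrite mulr_ge0//; lra.
  have h1 : (N - N') * l <= (s ^+ 2 * z) * (s ^+ 2 * q ^+ 2).
    by rewrite ler_pM// subr_ge0.
  have h2 : N' * (l - l' + lk) <= s ^+ 4 / 2 * (5 * ((1 + z) * q ^+ 2)).
    apply: (@le_trans _ _ (N' * (5 * ((1 + z) * q ^+ 2)))).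
      rewrite ler_wpM2l//.
      have : (1 + z) * 1 <= (1 + z) * q ^+ 2 by rewrite ler_wpM2l//; lra.
      by lra.
    by rewrite ler_wpM2r ?mulr_ge0 ?exprn_ge0//; lra.
  have h3 : 0 <= s ^+ 4 * q ^+ 2 by rewrite mulr_ge0 ?exprn_ge0.
  by lra.
have zN : 8 * s ^+ 4 * (1 + z) * q ^+ 2 <= N * (c * m) * q ^+ 2.
  rewrite ler_wpM2r ?exprn_ge0//.
  apply: (@le_trans _ _ (s ^+ 4 / 4 * (32 * (1 + z)))); first lra.
  by rewrite ler_pM ?mulr_ge0 ?exprn_ge0 ?invr_ge0//; lra.
have NQ : 2 * N * q ^+ 2 <= s ^+ 4 * (1 + z) * q ^+ 2.
  rewrite ler_wpM2r ?exprn_ge0//.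
  have : 0 <= s ^+ 4 * z by rewrite mulr_ge0 ?exprn_ge0.
  by lra.
have sq : (U + g) ^+ 2 <= 2 * N' * (l' - lk).
  have -> : (U + g) ^+ 2 = U ^+ 2 + (2 * U * g + g ^+ 2) by ring.
  rewrite UE; lra.
by rewrite -[leLHS]ger0_norm ?addr_ge0// -sqrtr_sqr ler_wsqrtr.
Qed.

Lemma threshold_slack (u b e l x : R) : u <= x ^+ 2 / 64 -> x ^+ 2 / 16 <= b ->
  40 * e * l * x <= x * x -> u + 5 / 8 * e * (x * l) <= b - x ^+ 2 / 32.
Proof. by rewrite -expr2; lra. Qed.

End Compare.

(** * The window of overlaps *)

Section Window.
Context {R : realType}.
Variable alpha : R.
Hypotheses (alpha_ge : 1 / 2 <= alpha) (alpha_lt : alpha < 2 / 3).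

Definition zeta_regular (D : R) (n : nat) : Prop :=
  [/\ D * Num.sqrt (Kpow alpha n)%:R <= zeta D (Kpow alpha n),
      D * (Num.sqrt (Kpow alpha n)%:R * Num.sqrt (ln n%:R)) <= 2 * zeta D (Kpow alpha n),
      4 * zeta D (Kpow alpha n) <= (Kpow alpha n)%:R :> R,
      2 <= zeta D (Kpow alpha n) :> R &
      ln (Kpow alpha n)%:R <= ln n%:R :> R].

Lemma near_zeta (D : R) : 0 < D -> \forall n \near \oo, zeta_regular D n.
Proof.
move=> D0; have D16 : 0 <= 16 * D ^+ 2 by rewrite mulr_ge0 ?exprn_ge0// ltW.
near=> n.
have n0 : 0 < n%:R :> R by rewrite ltr0n; near: n; exact: (nbhs_infty_gt 0).
have k1 : expR 1 <= (Kpow alpha n)%:R :> R by near: n; exact: near_Kpow_ge.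
have kD : (2 / D) ^+ 2 <= (Kpow alpha n)%:R :> R by near: n; exact: near_Kpow_ge.
have kn : 1 * (Kpow alpha n)%:R <= n%:R :> R by near: n; exact: near_Kpow_le_id.
have lk : ln n%:R <= 4 * ln (Kpow alpha n)%:R :> R by near: n; exact: near_ln_le_ln_Kpow.
have lnk : 16 * D ^+ 2 * ln n%:R <= (Kpow alpha n)%:R by near: n; exact: near_ln_le_Kpow.
move: k1 kD kn lk lnk; rewrite /zeta_regular mul1r; set k : R := (Kpow alpha n)%:R.
move=> k1 kD kn lk lnk.
have k0 : 0 < k by apply: lt_le_trans k1; rewrite expR_gt0.
have lk1 : 1 <= ln k by rewrite -[leLHS]expRK ler_ln ?posrE ?expR_gt0.
have lkn : ln k <= ln n%:R by rewrite ler_ln ?posrE.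
have s_le : Num.sqrt k <= Num.sqrt (k * ln k) by rewrite ler_wsqrtr// ler_peMr// ltW.
have z1 : D * Num.sqrt k <= D * Num.sqrt (k * ln k) by rewrite ler_wpM2l// ltW.
split => //; rewrite ?/zeta -/k //.
- rewrite [leRHS]mulrCA ler_wpM2l ?(ltW D0)// (sqrtrM _ (ltW k0)).
  rewrite [leRHS]mulrCA ler_wpM2l ?sqrtr_ge0//.
  have -> : 2 = Num.sqrt 4 :> R.
    by have -> : 4 = 2 ^+ 2 :> R by [ring]; rewrite sqrtr_sqr ger0_norm.
  by rewrite -sqrtrM// ler_wsqrtr.
- have kl0 : 0 <= k * ln k by rewrite mulr_ge0 ?(ltW k0)//; lra.
  rewrite mulrA -(@ler_pXn2r _ 2) ?nnegrE ?(ltW k0)//; last first.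
    by rewrite !mulr_ge0 ?sqrtr_ge0// ltW.
  have -> : (4 * D * Num.sqrt (k * ln k)) ^+ 2 = 16 * D ^+ 2 * Num.sqrt (k * ln k) ^+ 2 by ring.
  rewrite sqr_sqrtr// mulrCA expr2 ler_wpM2l ?(ltW k0)//; apply: le_trans lnk.
  by rewrite ler_wpM2l.
- apply: le_trans z1; rewrite -ler_pdivrMl// mulrC.
  rewrite -[leLHS]ger0_norm ?divr_ge0 ?(ltW D0)//.
  by rewrite -sqrtr_sqr ler_wsqrtr.
Unshelve. all: by end_near. Qed.

Lemma truncn_zeta (D : R) (K : nat) : 2 <= zeta D K -> 4 * zeta D K <= K%:R ->
  [/\ (0 < Num.truncn (zeta D K))%N, (Num.truncn (zeta D K) <= K)%N,
      (Num.truncn (zeta D K))%:R <= zeta D K &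
      zeta D K <= 2 * (Num.truncn (zeta D K))%:R].
Proof.
move: (zeta _ _) => Z Z2 ZK.
have /andP[] := truncn_itv (le_trans (ler0n _ 2) Z2).
rewrite -[_.+1%:R]natr1 => h1 h2.
split=> //; first by rewrite truncn_gt0; lra.
- by rewrite -(ler_nat R); lra.
- lra.
Qed.

(** Since m is at least D sqrt(K) / 2, the quotient e K^2 / (n m) is at most a
    constant times K^(3/2) / n, hence at most n^(-c). *)
Lemma near_count (D : R) : 0 < D -> \forall n \near \oo,
  let m := Num.truncn (zeta D (Kpow alpha n)) in
  ('C(Kpow alpha n, m) * 'C(n - m, Kpow alpha n - m))%:R <=
  expR (ln 'C(n, Kpow alpha n)%:R - (1 - 3 / 2 * alpha) / 2 * m%:R * ln n%:R) :> R.
Proof.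
move=> D0; have C0 : 0 <= 2 * expR 1 / D by rewrite divr_ge0 ?mulr_ge0 ?expR_ge0// ltW.
near=> n.
have [z1 _ z3 z4 _] : zeta_regular D n by near: n; exact: near_zeta.
have n0 : 0 < n%:R :> R by rewrite ltr0n; near: n; exact: (nbhs_infty_gt 0).
have kn : 1 * (Kpow alpha n)%:R <= n%:R :> R by near: n; exact: near_Kpow_le_id.
have h : 2 * expR 1 / D * ((Kpow alpha n)%:R * Num.sqrt (Kpow alpha n)%:R) *
   n%:R `^ ((1 - 3 / 2 * alpha) / 2) <= n%:R.
  by near: n; exact: near_Kpow_sqrt_le.
have [m0 mK m1 m2] := truncn_zeta z4 z3.
move: m0 mK m1 m2 h z1 kn; rewrite /=.
move: (Num.truncn _) => m; move: (zeta _ _) {z3 z4} => Z.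
move: (Kpow alpha n) => K m0 mK m1 m2 h z1; rewrite mul1r ler_nat => Kn.
apply: (le_trans (overlap_count_le m0 mK Kn)).
have CnK : 0 < 'C(n, K)%:R :> R by rewrite ltr0n bin_gt0.
rewrite expRD lnK ?posrE// ler_wpM2l//.
set c := (1 - _) / 2 in h *.
have -> : - (c * m%:R * ln n%:R) = m%:R * (- (c * ln n%:R)) by ring.
have r0 : 0 <= expR 1 * K%:R ^+ 2 / (n%:R * m%:R) :> R.
  by rewrite divr_ge0 ?mulr_ge0 ?expR_ge0 ?exprn_ge0.
rewrite expRM_natl lerXn2r ?nnegrE ?expR_ge0//.
rewrite expRN -ln_powR lnK ?posrE ?powR_gt0//.
have mr0 : 0 < m%:R :> R by rewrite ltr0n.
rewrite ler_pdivrMr ?mulr_gt0// ler_pdivlMl ?powR_gt0//.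
have sK := sqr_sqrtr (ler0n R K); set s := Num.sqrt _ in sK h z1.
have s0 : 0 <= s by rewrite sqrtr_ge0.
have h2 : (2 * expR 1 / D * (K%:R * s) * n%:R `^ c) * (D * s / 2) <= n%:R * m%:R.
  rewrite ler_pM//; last by lra.
  - by rewrite !mulr_ge0 ?expR_ge0 ?powR_ge0 ?invr_ge0// ltW.
  - by rewrite !mulr_ge0 ?invr_ge0// ltW.
apply: le_trans h2; rewrite le_eqVlt; apply/orP; left; apply/eqP.
rewrite -sK; field; rewrite gt_eqF//.
Unshelve. all: by end_near. Qed.

End Window.

(** * Thresholds *)

Section WithHighProbability.
Context {R : realType}.
Variable alpha : R.
Hypotheses (alpha_ge : 1 / 2 <= alpha) (alpha_lt : alpha < 2 / 3).
Let c : R := (1 - 3 / 2 * alpha) / 2.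
Variable D : R.
Hypothesis D0 : 0 < D.
Notation K n := (Kpow alpha n).
Notation z n := (low_overlap (4 : R) n (K n)).
Notation m n := (Num.truncn (zeta D (K n))).

Let c0 : 0 < c. Proof. by rewrite /c; move: alpha_lt; lra. Qed.

(** Bound for ZR over all K-sets of overlap at least m; the summand ln n makes
    the union bound fail with probability 1 / n only. *)
Definition upper_thr (n : nat) : R :=
  Num.sqrt (2 * 'C(K n, 2)%:R *
    (ln 'C(n, K n)%:R - c * (m n)%:R * ln n%:R + ln n%:R)).

(** Number of edges guaranteed outside the window.  The gap between the square
    roots is c D / 48 K ln n; three eighths of it pay for the errors of the
    conjectured bound, of the crossing coins and of the pairs among the low
    overlap. *)
Definition lower_thr (n : nat) : R :=
  ('C(K n, 2)%:R + upper_thr n + 5 / 8 * (c * D / 48) * ((K n)%:R * ln n%:R)) / 2.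

Lemma near_gap : \forall n \near \oo, forall n' k' : nat,
  k' = (K n - z n)%N ->
  Kpow alpha n' = k' -> (forall i : nat, k'%:R <= i%:R `^ alpha -> (n' <= i)%N) ->
  (K n + n' <= n)%N /\
  upper_thr n + c * D / 48 * ((K n)%:R * ln n%:R) <= Lbound n' k'.
Proof.
have cDp : 0 < c * D by exact: mulr_gt0.
have cD0 : 0 <= c * D by exact: ltW.
have C0 : 0 <= 96 / (c * D) by rewrite divr_ge0.
have C1 : 0 <= (c * D / 48) ^+ 2 by rewrite exprn_ge0// divr_ge0.
near=> n; move=> n' k' k'E Kn' n'min.
have [le_n kn' shift_le] : [/\ (K n + n' <= n)%N, (k' < n')%N &
      k'%:R * ((n - n')%:R / (n' - k')%:R) <= 4 * (1 + (z n)%:R) :> R].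
  move: n' k' k'E Kn' n'min; near: n; exact: near_smaller_graph.
have [z1 z2 z3 z4 lkn] : zeta_regular alpha D n by near: n; exact: near_zeta.
have n0 : 0 < n%:R :> R by rewrite ltr0n; near: n; exact: (nbhs_infty_gt 0).
have ln1 : 1 <= ln n%:R :> R by near: n; exact: near_ln_ge.
have k8 : 8 <= (K n)%:R :> R by near: n; exact: near_Kpow_ge.
have zs : 96 / (c * D) * (1 + (z n)%:R) <= Num.sqrt (K n)%:R by near: n; exact: near_low_overlap_le.
have zs2 : 2 * (1 + (z n)%:R) <= Num.sqrt (K n)%:R :> R by near: n; exact: near_low_overlap_le.
have ck : (c * D / 48) ^+ 2 * ln n%:R <= (K n)%:R by near: n; exact: near_ln_le_Kpow.
have count : ('C(K n, m n) * 'C(n - m n, K n - m n))%:R <=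
  expR (ln 'C(n, K n)%:R - c * (m n)%:R * ln n%:R) :> R.
  by near: n; exact: (near_count alpha_ge alpha_lt D0).
have [m0 mK m1 m2] := truncn_zeta z4 z3.
split=> //; rewrite /upper_thr /Lbound.
move: mK m1 m2 shift_le count z1 z2 z3 z4 le_n k8 zs zs2 ck lkn k'E {Kn' n'min}.
move: (zeta _ _) => Z; move: (Num.truncn Z) => m.
move: (low_overlap _ _ _) => z; move: (Kpow alpha n) => K.
move=> mK m1 m2 shift_le count z1 z2 z3 z4 le_n k8 zs zs2 ck lkn k'E.
have [s0 sk] : 0 <= Num.sqrt (K%:R : R) /\ Num.sqrt (K%:R : R) ^+ 2 = K%:R.
  by rewrite sqrtr_ge0 sqr_sqrtr.
have [q0 qk] : 0 <= Num.sqrt (ln n%:R : R) /\ Num.sqrt (ln n%:R : R) ^+ 2 = ln n%:R.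
  by rewrite sqrtr_ge0 sqr_sqrtr//; clear -alpha_ge alpha_lt D0 c0 ln1; lra.
have q1 : 1 <= Num.sqrt (ln n%:R : R) by rewrite -[leLHS]sqrtr1 ler_wsqrtr.
have sK : Num.sqrt K%:R <= K%:R :> R.
  have s1 : 1 <= Num.sqrt K%:R :> R.
    by rewrite -[leLHS]sqrtr1 ler_wsqrtr//; clear -alpha_ge alpha_lt D0 c0 k8; lra.
  by rewrite -[leRHS]sk expr2 ler_peMr.
have Kn : (K <= n)%N by rewrite (leq_trans _ le_n)// leq_addr.
have zK : (z <= K)%N.
  by rewrite -(ler_nat R); have : 0 <= z%:R :> R by []; clear -alpha_ge alpha_lt D0 c0 zs2 sK; lra.
have kE : (z + k')%N = K by rewrite k'E subnKC.
have n'n : (n' <= n)%N by rewrite (leq_trans _ le_n)// leq_addl.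
have k'0 : (0 < k')%N.
  by rewrite k'E subn_gt0 -(ltr_nat R); have : 0 <= z%:R :> R by []; clear -alpha_ge alpha_lt D0 c0 zs2 sK; lra.
have k'0R : 0 < k'%:R :> R by rewrite ltr0n.
have C'0 : 0 < 'C(n', k')%:R :> R by rewrite ltr0n bin_gt0 ltnW.
rewrite lnM ?posrE ?invr_gt0// lnV ?posrE// -qk -sk.
apply: (@sqrt_gap _ _ _ _ _ _ _ _ z%:R) => //.
- by rewrite ler_nat leq_bin2l// k'E leq_subr.
- have -> : Num.sqrt K%:R ^+ 4 = K%:R ^+ 2 :> R by rewrite -[4%N]/(2 * 2)%N exprM sk.
  by rewrite bin2E; clear -alpha_ge alpha_lt D0 c0 k8; nra.
- have -> : Num.sqrt K%:R ^+ 4 = K%:R ^+ 2 :> R by rewrite -[4%N]/(2 * 2)%N exprM sk.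
  by rewrite bin2E; clear -alpha_ge alpha_lt D0 c0 k8; nra.
- rewrite sk -kE bin2D addnAC natrD addrK -natrM ler_nat.
  rewrite mulnDl [(k' * z)%N]mulnC leq_add2r bin2 -divn2.
  by rewrite (leq_trans (leq_div _ _))// leq_mul2l leq_pred orbT.
- by rewrite sk qk ln_bin_le_mul.
(* the counted family is nonempty, so that the bound on its size is at least 1 *)
- rewrite qk -subr_ge0 -ler_expR expR0; apply: le_trans count.
  by rewrite ler1n muln_gt0 !bin_gt0 mK leq_sub2r.
- have := @ln_bin_le R n k' z n' kn' n'n; rewrite kE => /(_ Kn) => h.
  by rewrite qk; clear -alpha_ge alpha_lt D0 c0 h shift_le; lra.
- rewrite qk; apply: le_trans lkn; rewrite ler_ln ?posrE//; last by clear -alpha_ge alpha_lt D0 c0 k8; lra.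
  by rewrite ler_nat k'E leq_subr.
- have := ler_wpM2l cD0 zs.
  rewrite mulrA [c * D * (96 / _)]mulrC (divfK (lt0r_neq0 cDp)) => h.
  have : 0 <= z%:R :> R by [].
  have : c * (D * Num.sqrt K%:R) <= c * (2 * m%:R) by rewrite ler_wpM2l ?(ltW c0)//; clear -alpha_ge alpha_lt D0 c0 z1 m2; lra.
  by clear -alpha_ge alpha_lt D0 c0 h; lra.
- by apply: (le_trans z2); clear -alpha_ge alpha_lt D0 c0 m2; lra.
- have h0 : 0 <= c * D / 48 by rewrite divr_ge0.
  rewrite -(@ler_pXn2r _ 2) ?nnegrE ?(mulr_ge0 h0 q0)//.
  have -> : (c * D / 48 * Num.sqrt (ln n%:R)) ^+ 2 =
      (c * D / 48) ^+ 2 * Num.sqrt (ln n%:R) ^+ 2 by ring.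
  by rewrite qk sk.
Unshelve. all: by end_near. Qed.

End WithHighProbability.

(** * High-probability bounds at the three ranges of overlap *)

Section Whp.
Context {R : realType}.
Variable alpha : R.
Hypotheses (alpha_ge : 1 / 2 <= alpha) (alpha_lt : alpha < 2 / 3).
Let c : R := (1 - 3 / 2 * alpha) / 2.
Variable D : R.
Hypothesis D0 : 0 < D.
Notation K n := (Kpow alpha n).
Notation z n := (low_overlap (4 : R) n (K n)).
Notation m n := (Num.truncn (zeta D (K n))).
Notation U n := (upper_thr alpha D n).
Notation B n := (lower_thr alpha D n).

Let c0 : 0 < c. Proof. by rewrite /c; move: alpha_lt; lra. Qed.

Lemma whp_upper : whp R (fun n => [set w : coins n | forall S : {set 'I_n},
  #|S| = K n -> (m n <= #|S :&: PC n (K n)|)%N -> ZR w S <= U n]).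
Proof.
apply: (whp_small (b := fun n => (ln n%:R)^-1)); last exact: cvg_invr_ln.
near=> n.
have n0 : 0 < n%:R :> R by rewrite ltr0n; near: n; exact: (nbhs_infty_gt 0).
have ln1 : 1 <= ln n%:R :> R by near: n; exact: near_ln_ge.
have k2 : 2 <= (K n)%:R :> R by near: n; exact: near_Kpow_ge.
have kn : 1 * (K n)%:R <= n%:R :> R by near: n; exact: near_Kpow_le_id.
have [_ _ z3 z4 _] : zeta_regular alpha D n by near: n; exact: near_zeta.
have [_ mK _ _] := truncn_zeta z4 z3.
have count : ('C(K n, m n) * 'C(n - m n, K n - m n))%:R <=
  expR (ln 'C(n, K n)%:R - c * (m n)%:R * ln n%:R) :> R.
  by near: n; exact: (near_count alpha_ge alpha_lt D0).
have Kn : (K n <= n)%N by rewrite -(ler_nat R); lra.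
have K1 : (1 < K n)%N by rewrite -(ler_nat R).
pose F := [set S : {set 'I_n} | (#|S| == K n) && (m n <= #|S :&: PC n (K n)|)%N]%SET.
apply: (@le_trans _ _ (prob R [set w : coins n | exists2 S : {set 'I_n}, S \in F & U n < ZR w S])).
  apply: le_prob => w /= /existsNP[S].
  move=> /not_implyP[SK /not_implyP[mS /negP]]; rewrite -ltNge => US.
  by exists S => //; rewrite inE SK eqxx.
apply: (le_trans (prob_max_ZR (K := K n) _ _ _)) => //.
- by rewrite sqrtr_ge0.
- by move=> S; rewrite inE => /andP[/eqP].
have FC : #|F|%:R <= expR (ln 'C(n, K n)%:R - c * (m n)%:R * ln n%:R) :> R.
  apply: le_trans count; rewrite ler_nat -[X in 'C(X, _)](card_PC Kn).
  exact: card_overlap_le.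
apply: (le_trans (ler_wpM2r (expR_ge0 _) FC)).
rewrite -expRD.
apply: (@le_trans _ _ (expR (- ln n%:R))); last first.
  rewrite expRN lnK ?posrE// lef_pV2 ?posrE//; last by lra.
  by apply/ltW/ln_sublinear.
rewrite ler_expR /upper_thr -/c.
set Q := ln 'C(n, K n)%:R - _ + ln n%:R; have N0 : 0 < 'C(K n, 2)%:R :> R by rewrite ltr0n bin_gt0.
have QU : Q <= Num.sqrt (2 * 'C(K n, 2)%:R * Q) ^+ 2 / (2 * 'C(K n, 2)%:R).
  have N20 : 0 < 2 * 'C(K n, 2)%:R :> R by rewrite mulr_gt0.
  (* a negative Q makes the square root 0 and the bound trivial *)
  have [Q0|Q0] := lerP 0 Q.
    by rewrite sqr_sqrtr ?mulr_ge0 ?(ltW N20)// mulrAC divff ?mul1r// gt_eqF.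
  by apply: (le_trans (ltW Q0)); rewrite divr_ge0 ?sqr_ge0 ?(ltW N20).
have QE : Q = ln 'C(n, K n)%:R - c * (m n)%:R * ln n%:R + ln n%:R by [].
move: QU QE; move: (_ / _) => V; clearbody Q => QV QE; lra.
Unshelve. all: by end_near. Qed.

(** The left-hand side is N / 2 up to a term of order K^(3/2) sqrt(ln n), and
    the right-hand side exceeds N / 2 by a multiple of K^2. *)
Lemma near_lower_thr_small : \forall n \near \oo,
  B n <= ('C(K n, 2)%:R + 'C(K n %/ 2, 2)%:R - (K n)%:R ^+ 2 / 32) / 2.
Proof.
have cD : 0 <= c * D by rewrite ltW// mulr_gt0.
have C0 : 0 <= 40 * (c * D / 48) by rewrite mulr_ge0// divr_ge0.
near=> n.
have n0 : 0 < n%:R :> R by rewrite ltr0n; near: n; exact: (nbhs_infty_gt 0).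
have ln1 : 1 <= ln n%:R :> R by near: n; exact: near_ln_ge.
have k8 : 8 <= (K n)%:R :> R by near: n; exact: near_Kpow_ge.
have kn : 1 * (K n)%:R <= n%:R :> R by near: n; exact: near_Kpow_le_id.
have kl2 : 40 * (c * D / 48) * ln n%:R <= (K n)%:R :> R by near: n; exact: near_ln_le_Kpow.
rewrite /lower_thr -/c ler_wpM2r ?invr_ge0// -!addrA lerD2l.
have Kn : (K n <= n)%N by rewrite -(ler_nat R) -[leLHS]mul1r.
have Ule : U n <= (K n)%:R ^+ 2 / 64.
  have k64 : 0 <= (K n)%:R ^+ 2 / 64 :> R by rewrite divr_ge0 ?exprn_ge0.
  rewrite -[leRHS]ger0_norm// -sqrtr_sqr ler_wsqrtr//.
  (* U^2 <= K^2 (2 K ln n), and 64 * 128 = 2 * 64^2 turns this into (K^2 / 64)^2 *)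
  apply: (@le_trans _ _ ((K n)%:R ^+ 2 * (2 * (K n)%:R * ln n%:R))).
    apply: (@le_trans _ _ (2 * 'C(K n, 2)%:R * (2 * (K n)%:R * ln n%:R))).
      rewrite ler_wpM2l ?mulr_ge0//.
      have := @ln_bin_le_mul R n (K n) Kn.
      have : 0 <= c * (m n)%:R * ln n%:R.
        exact: mulr_ge0 (mulr_ge0 (ltW c0) (ler0n _ _)) (le_trans ler01 ln1).
      rewrite -/c.
      have : 1 * ln n%:R <= (K n)%:R * ln n%:R :> R by rewrite ler_wpM2r//; lra.
      by lra.
    rewrite ler_wpM2r ?mulr_ge0//; first by lra.
    by rewrite bin2E; nra.
  have -> : ((K n)%:R ^+ 2 / 64) ^+ 2 =
      (K n)%:R ^+ 2 * (2 * (K n)%:R * ((K n)%:R / (64 * 128))) :> R.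
    by field.
  rewrite ler_wpM2l ?exprn_ge0// ler_wpM2l ?mulr_ge0//.
  rewrite ler_pdivlMr ?mulr_gt0// mulrC; near: n.
  by apply: near_ln_le_Kpow; rewrite // mulr_ge0.
have h_ge := half_ge (K n).
have h_bin := half_bin_ge k8.
have {}kl2 := ler_wpM2r (ler0n R (K n)) kl2.
exact: threshold_slack Ule h_bin kl2.
Unshelve. all: by end_near. Qed.

Lemma whp_high : whp R (fun n => [set w : coins n | exists S : {set 'I_n},
  [/\ #|S| = K n, #|S :&: PC n (K n)| = (K n %/ 2)%N &
      B n <= (nedges (K n) w S)%:R]]).
Proof.
apply: (whp_small (b := fun n => (ln n%:R)^-1)); last exact: cvg_invr_ln.
near=> n.
have n0 : 0 < n%:R :> R by rewrite ltr0n; near: n; exact: (nbhs_infty_gt 0).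
have ln1 : 1 <= ln n%:R :> R by near: n; exact: near_ln_ge.
have k2 : 32 * 16 <= (K n)%:R :> R by near: n; exact: near_Kpow_ge.
have kn : 2 * (K n)%:R <= n%:R :> R by near: n; exact: near_Kpow_le_id.
have kl : 1 * ln n%:R <= (K n)%:R :> R by near: n; exact: near_ln_le_Kpow.
have Ble : B n <= ('C(K n, 2)%:R + 'C(K n %/ 2, 2)%:R - (K n)%:R ^+ 2 / 32) / 2.
  by near: n; exact: near_lower_thr_small.
have k0 : 0 < (K n)%:R :> R by lra.
have t0 : 0 < (K n)%:R ^+ 2 / 32 :> R by rewrite divr_gt0 ?exprn_gt0.
have le_n : (K n + (K n - K n %/ 2) <= n)%N.
  have : (K n * 2 <= n)%N by rewrite -(ler_nat R) natrM mulrC.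
  by move: (K n) => k {}kn; clear -kn; lia.
apply: le_trans (le_trans (prob_high_overlap (leq_div _ 2) le_n t0) _).
  apply: le_prob => w /= noS [S [SK Sz Se]]; apply: noS; exists S; split => //.
  exact: le_trans Ble Se.
rewrite bin2E ler_pdivrMr ?exprn_gt0// ler_pdivlMl; last by lra.
apply: (@le_trans _ _ ((K n)%:R * ((K n)%:R * (K n)%:R / 2))).
  by rewrite ler_pM//; [lra|rewrite divr_ge0 ?mulr_ge0//; lra|lra|nra].
have -> : ((K n)%:R ^+ 2 / 32) ^+ 2 = (K n)%:R ^+ 3 * ((K n)%:R / (32 * 32)) :> R by field.
have -> : (K n)%:R * ((K n)%:R * (K n)%:R / 2) = (K n)%:R ^+ 3 * (1 / 2) :> R by field.
by rewrite ler_wpM2l ?exprn_ge0//; lra.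
Unshelve. all: by end_near. Qed.

(** The errors are split into three equal parts eps K ln n: the one allowed by
    the conjectured bound, the crossing coins, and the pairs among the low
    overlap. *)
Lemma whp_low : unplanted_lower_bound (R := R) (Kpow alpha) ->
  whp R (fun n => [set w : coins n | exists S : {set 'I_n},
  [/\ #|S| = K n, #|S :&: PC n (K n)| = z n &
      B n <= (nedges (K n) w S)%:R]]).
Proof.
have cD : 0 < c * D by exact: mulr_gt0.
pose eps : R := c * D / 48 / 8; have eps0 : 0 < eps by rewrite !divr_gt0.
move=> /(_ _ eps0) /whp_setC E0.
have /choice[g gP] : forall j : nat, exists n' : nat, (0 < j)%N ->
    Kpow alpha n' = j /\ forall i : nat, j%:R <= i%:R `^ alpha -> (n' <= i)%N.
  move=> j; have [->|j0] := posnP j; first by exists 0%N.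
  by have [n' n'P] := Kpow_onto alpha_ge alpha_lt j0; exists n'.
(* the number of vertices of the smaller graph *)
pose n' n := g (K n - z n)%N.
have near_k' (C : R) : \forall n \near \oo, C <= (K n - z n)%:R.
  near=> n.
  have k1 : 1 <= (K n)%:R :> R by near: n; exact: near_Kpow_ge.
  have kC : 2 * C <= (K n)%:R :> R by near: n; exact: near_Kpow_ge.
  have zs : 2 * (1 + (z n)%:R) <= Num.sqrt (K n)%:R :> R by near: n; exact: near_low_overlap_le.
  have sk : Num.sqrt (K n)%:R <= (K n)%:R :> R.
    rewrite -[leRHS](sqr_sqrtr (ler0n _ _)) expr2 ler_peMr//.
    by rewrite -[leLHS]sqrtr1 ler_wsqrtr.
  have zK : (z n <= K n)%N by rewrite -(ler_nat R); have : 0 <= (z n)%:R :> R by []; lra.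
  by rewrite natrB//; lra.
have n'_oo : n' n @[n --> \oo] --> \oo.
  apply/cvgnyPge => A; near=> n.
  have k'A : A%:R + 1 <= (K n - z n)%:R :> R by near: n; exact: near_k'.
  have k'0 : (0 < K n - z n)%N by rewrite -(ltr_nat R); have : 0 <= A%:R :> R by []; lra.
  have [gK _] := gP _ k'0; have /andP[+ _] := Kpow_itv alpha (n' n).
  rewrite /n' gK => h; rewrite -(ler_nat R).
  have gn0 : 1 <= (g (K n - z n)%N)%:R :> R.
    rewrite ler1n lt0n; apply/eqP => g0; move: gK k'0; rewrite g0 /Kpow.
    by rewrite powR0 ?truncn0 => [<-//|]; move: alpha_ge; lra.
  have : (g (K n - z n)%N)%:R `^ alpha <= (g (K n - z n)%N)%:R :> R.
    by rewrite ler1_powR//; move: alpha_lt; lra.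
  by lra.
pose b (n : nat) : R := prob R (~` [set u : coins (n' n) |
  ((Lbound (n' n) (K (n' n)) - eps * (K (n' n))%:R * ln (n' n)%:R)%:E <= PsiR (K (n' n)) u)%E]).
have {}E0 : b n @[n --> \oo] --> (0 : R) := cvg_comp _ _ n'_oo E0.
have b0 : b n + (ln n%:R)^-1 @[n --> \oo] --> (0 + 0 : R).
  by apply: cvgD => //; exact: cvg_invr_ln.
rewrite addr0 in b0; apply: whp_small b0; rewrite /b.
near=> n.
have n0 : 0 < n%:R :> R by rewrite ltr0n; near: n; exact: (nbhs_infty_gt 0).
have ln1 : 1 <= ln n%:R :> R by near: n; exact: near_ln_ge.
have lne : (eps ^+ 2)^-1 <= ln n%:R :> R by near: n; exact: near_ln_ge.
have k1 : 1 <= (K n)%:R :> R by near: n; exact: near_Kpow_ge.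
have k'1 : 1 <= (K n - z n)%:R :> R by near: n; exact: near_k'.
have zs : eps^-1 * (1 + (z n)%:R) <= Num.sqrt (K n)%:R :> R.
  by near: n; apply: near_low_overlap_le => //; rewrite invr_ge0 ltW.
have zs1 : 1 * (1 + (z n)%:R) <= Num.sqrt (K n)%:R :> R by near: n; exact: near_low_overlap_le.
have k'0 : (0 < K n - z n)%N by rewrite -(ler_nat R).
have [gK gmin] := gP _ k'0.
have [le_n gap] : (K n + n' n <= n)%N /\
    U n + c * D / 48 * ((K n)%:R * ln n%:R) <= Lbound (n' n) (K n - z n).
  move: gK gmin; near: n; apply: filterS (near_gap alpha_ge alpha_lt D0) => n h.
  exact: h erefl.
have sk := sqr_sqrtr (ler0n R (K n)).
have sK : Num.sqrt (K n)%:R <= (K n)%:R :> R.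
  by rewrite -[leRHS]sk expr2 ler_peMr// -[leLHS]sqrtr1 ler_wsqrtr.
have z0 : 0 <= (z n)%:R :> R by [].
have zK : (z n <= K n)%N by rewrite -(ler_nat R); lra.
have kE : (z n + (K n - z n))%N = K n by rewrite subnKC.
pose t := eps * ((K n)%:R * ln n%:R).
have kl0 : 0 < (K n)%:R * ln n%:R :> R by rewrite mulr_gt0//; clear -alpha_ge alpha_lt D0 c0 k1 ln1; lra.
have t0 : 0 < t by rewrite mulr_gt0.
have n'0 : (0 < n' n)%N.
  rewrite lt0n; apply/eqP => g0; move: gK k'0; rewrite -/(n' n) g0 /Kpow.
  by rewrite powR0 ?truncn0 => [<-//|]; move: alpha_ge; lra.
pose a : R := Lbound (n' n) (K n - z n) - eps * (K n - z n)%:R * ln (n' n)%:R.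
have := prob_low_overlap (K n - z n)%N a le_n zK t0; rewrite kE.
have B_le (w : coins n) (S : {set 'I_n}) : #|S| = K n ->
    a - t - 'C(z n, 2)%:R <= ZR w S -> B n <= (nedges (K n) w S)%:R.
  move=> SK Sa; have := @nedges_ge R n (K n) w S; rewrite SK; apply: le_trans.
  rewrite /lower_thr ler_wpM2r ?invr_ge0// -addrA lerD2l; apply: le_trans Sa.
  have a_ge : Lbound (n' n) (K n - z n) - t <= a.
    rewrite lerD2l lerN2 /t -mulrA ler_wpM2l ?(ltW eps0)// ler_pM//.
    - by rewrite ln_ge0// ler1n.
    - by rewrite ler_nat leq_subr.
    - rewrite ler_ln ?posrE ?ltr0n// ?ler_nat; last by rewrite -(ltr0n R).
      by rewrite (leq_trans _ le_n)// leq_addl.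
  have z_le : 'C(z n, 2)%:R <= t.
    have z1 : (z n)%:R <= eps * Num.sqrt (K n)%:R.
      by rewrite -ler_pdivrMl//; apply: le_trans zs; rewrite ler_wpM2l ?invr_ge0 ?(ltW eps0)//; clear -alpha_ge alpha_lt D0 c0 z0; lra.
    have z2 : (z n)%:R * (z n)%:R <= eps * Num.sqrt (K n)%:R ^+ 2.
      by rewrite expr2 mulrA ler_pM//; clear -alpha_ge alpha_lt D0 c0 z1 zs1 z0; lra.
    have kl : eps * (K n)%:R <= t by rewrite /t ler_wpM2l ?(ltW eps0)// ler_peMr.
    by rewrite sk in z2; exact: bin2_le_sqr (le_trans z2 kl).
  have epsE : c * D / 48 = 8 * eps by rewrite /eps; field.
  rewrite -/c epsE; rewrite epsE in gap; rewrite /t in a_ge z_le *.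
  by clear -alpha_ge alpha_lt D0 c0 gap a_ge z_le; lra.
move=> P_le; apply: (@le_trans _ _ (prob R [set w : coins n | ~ exists S : {set 'I_n},
    [/\ #|S| = K n, #|S :&: PC n (K n)| = z n & a - t - 'C(z n, 2)%:R <= ZR w S]])).
  apply: le_prob => w /= noS [S [SK Sz Sa]]; apply: noS; exists S; split => //.
  exact: B_le Sa.
apply: (le_trans P_le); rewrite lerD//.
  apply: le_prob => u /= noS; rewrite gK -/a => /PsiR_attained[S Sk Sa].
  by apply: noS; exists S.
rewrite ler_pdivrMr ?exprn_gt0// ler_pdivlMl; last by clear -alpha_ge alpha_lt D0 c0 ln1; lra.
have h1 : 1 <= eps ^+ 2 * ln n%:R by rewrite -ler_pdivrMl ?exprn_gt0// mulr1.
have h2 : (z n * (K n - z n))%:R <= (K n)%:R ^+ 2 :> R.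
  by rewrite natrM expr2 ler_pM// ler_nat// leq_subr.
apply: (@le_trans _ _ (ln n%:R * (K n)%:R ^+ 2)).
  by rewrite ler_wpM2l//; clear -alpha_ge alpha_lt D0 c0 ln1; lra.
have -> : t ^+ 2 = (eps ^+ 2 * ln n%:R) * (ln n%:R * (K n)%:R ^+ 2) by rewrite /t; ring.
by rewrite ler_peMl// mulr_ge0 ?exprn_ge0//; clear -alpha_ge alpha_lt D0 c0 ln1; lra.
Unshelve. all: by end_near. Qed.


End Whp.

(** * The overlap gap *)

Section OGPproof.
Context {R : realType}.

Lemma PsiBern_ge (n K : nat) (w : coins n) (S : {set 'I_n}) : #|S| = K ->
  (nedges K w S <= PsiBern K w #|S :&: PC n K|)%N.
Proof. by move=> SK; apply: leq_bigmax_cond; rewrite SK !eqxx. Qed.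

Lemma PsiBern_attained (n K z : nat) (w : coins n) (S : {set 'I_n}) :
  #|S| = K -> #|S :&: PC n K| = z ->
  exists A : {set 'I_n}, [/\ #|A| = K, #|A :&: PC n K| = z & nedges K w A = PsiBern K w z].
Proof.
move=> SK Sz.
have : (0 < #|[pred A : {set 'I_n} | (#|A| == K) && (#|A :&: PC n K| == z)]|)%N.
  by apply/card_gt0P; exists S; rewrite inE SK Sz !eqxx.
move=> /(eq_bigmax_cond (nedges K w))[A]; rewrite inE => /andP[/eqP AK /eqP Az] AE.
by exists A; split => //; rewrite -AE; apply: eq_bigl => ?; rewrite inE.
Qed.

Lemma near_overlaps (alpha D : R) : 1 / 2 <= alpha -> alpha < 2 / 3 -> 0 < D ->
  \forall n \near \oo,
  [/\ 0 < zeta D (Kpow alpha n),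
      zeta (2 * D) (Kpow alpha n) <= (Kpow alpha n %/ 2)%:R,
      zeta (2 * D) (Kpow alpha n) < (Kpow alpha n)%:R,
      (low_overlap (4 : R) n (Kpow alpha n))%:R <= zeta D (Kpow alpha n) &
      (Kpow alpha n ^ 2 %/ n <= low_overlap (4 : R) n (Kpow alpha n))%N].
Proof.
move=> alpha_ge alpha_lt D0; have D20 : 0 < 2 * D by rewrite mulr_gt0.
have Di : 0 <= D^-1 by rewrite invr_ge0 ltW.
near=> n.
have n0 : 0 < n%:R :> R by rewrite ltr0n; near: n; exact: (nbhs_infty_gt 0).
have [z1 _ _ z4 _] : zeta_regular alpha D n by near: n; exact: near_zeta.
have [_ _ z3 z2 _] : zeta_regular alpha (2 * D) n by near: n; exact: near_zeta.
have zs : D^-1 * (1 + (low_overlap (4 : R) n (Kpow alpha n))%:R) <= Num.sqrt (Kpow alpha n)%:R.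
  by near: n; exact: near_low_overlap_le.
have /andP[_ zk] := low_overlap_itv alpha n.
have h_ge := @half_ge R (Kpow alpha n).
move: zk zs h_ge z1 z2 z3 z4; move: (zeta D _) (zeta (2 * D) _) => Z Z2.
rewrite /low_overlap; set z := Num.truncn _; move: (Kpow alpha n) @z => K z.
move=> zk zs h_ge z1 z2 z3 z4; split; try lra.
  by apply: le_trans z1; rewrite -ler_pdivrMl//; apply: le_trans zs; rewrite ler_wpM2l//; lra.
rewrite truncn_ge_nat ?divr_ge0 ?mulr_ge0 ?exprn_ge0// ler_pdivlMr// -natrM.
apply: (@le_trans _ _ (K ^ 2)%:R); first by rewrite ler_nat leq_divM.
by rewrite natrX ler_peMl ?exprn_ge0//; lra.
Unshelve. all: by end_near. Qed.

(** For one fixed n and one outcome w in the three events of high probability.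
    The value of D makes the planted excess 2 D^2 K ln K of the window equal to
    kappa / 8 K ln K. *)
Section Deterministic.
Variables (alpha : R) (n : nat) (w : coins n).
Let K := Kpow alpha n.
Let c : R := (1 - 3 / 2 * alpha) / 2.
Let D := c / 16 / 48.
Let kappa := c * D / 48.
Let z := low_overlap (4 : R) n K.
Let B := lower_thr alpha D n.
Let r2 : R := (minn (PsiBern K w z) (PsiBern K w (K %/ 2)))%:R.
Let r1 := r2 - kappa / 8 * K%:R * ln K%:R.

Hypothesis low : exists S : {set 'I_n},
  [/\ #|S| = K, #|S :&: PC n K| = z & B <= (nedges K w S)%:R].
Hypothesis high : exists S : {set 'I_n},
  [/\ #|S| = K, #|S :&: PC n K| = (K %/ 2)%N & B <= (nedges K w S)%:R].

Lemma thr_le_r2 : B <= r2.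
Proof.
have [S [SK Sz SB]] := low; have [T [TK Tz TB]] := high.
have := PsiBern_ge w SK; rewrite Sz => hS.
have := PsiBern_ge w TK; rewrite Tz => hT.
rewrite /r2; case: (leqP (PsiBern K w z) (PsiBern K w (K %/ 2))) => _.
  by apply: le_trans SB _; rewrite ler_nat.
by apply: le_trans TB _; rewrite ler_nat.
Qed.

Hypothesis c0 : 0 < c.
Hypothesis lnK0 : 0 < ln K%:R :> R.
Hypothesis K0 : 0 < K%:R :> R.
Hypothesis lnKn : ln K%:R <= ln n%:R :> R.
Hypothesis upper : forall S : {set 'I_n}, #|S| = K ->
  (Num.truncn (zeta D K) <= #|S :&: PC n K|)%N -> ZR w S <= upper_thr alpha D n.

Let kl0 : 0 < K%:R * ln K%:R :> R. Proof. exact: mulr_gt0. Qed.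
Let D0 : 0 < D. Proof. by apply: divr_gt0 => //; apply: divr_gt0. Qed.
Let kappa0 : 0 < kappa. Proof. by apply: divr_gt0 => //; exact: mulr_gt0. Qed.

Lemma lower_thr_ge :
  ('C(K, 2)%:R + upper_thr alpha D n) / 2 + 5 / 16 * (kappa * (K%:R * ln K%:R)) <= B.
Proof.
have : kappa * (K%:R * ln K%:R) <= kappa * (K%:R * ln n%:R).
  by rewrite ler_wpM2l ?(ltW kappa0)// ler_wpM2l ?(ltW K0).
rewrite /B /lower_thr -/K -/c -/kappa.
move: (kappa) (upper_thr _ _ _) (_ * ln K%:R) (_ * ln n%:R) => *; lra.
Qed.

Lemma r1_gt0 : 0 < r1.
Proof.
have := lower_thr_ge; have := thr_le_r2; rewrite /r1.
have : 0 < kappa * (K%:R * ln K%:R) by exact: mulr_gt0 kappa0 kl0.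
have : 0 <= upper_thr alpha D n by exact: sqrtr_ge0.
have : 0 <= 'C(K, 2)%:R :> R by [].
have -> : kappa / 8 * K%:R * ln K%:R = kappa * (K%:R * ln K%:R) / 8 by ring.
move: (_ * (K%:R * _)) r2 B (upper_thr _ _ _) ('C(K, 2)%:R : R) => *; lra.
Qed.

Lemma r1_lt_r2 : r1 < r2.
Proof. by rewrite /r1 ltrBlDr ltrDl -mulrA mulr_gt0// divr_gt0. Qed.

Lemma nedges_le_r1 (A : {set 'I_n}) : #|A| = K ->
  zeta D K <= #|A :&: PC n K|%:R -> #|A :&: PC n K|%:R <= zeta (2 * D) K ->
  (nedges K w A)%:R <= r1.
Proof.
move=> AK zA Az.
have Z0 : 0 <= zeta D K :> R by rewrite mulr_ge0 ?sqrtr_ge0 ?(ltW D0).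
have mA : (Num.truncn (zeta D K) <= #|A :&: PC n K|)%N.
  by rewrite -(ler_nat R); apply: le_trans zA; rewrite truncn_le.
have := nedges_le (R := R) K w A; rewrite AK (bin2E (#|A :&: PC n K|)) => /le_trans; apply.
have := upper AK mA; have := lower_thr_ge; have := thr_le_r2; rewrite /r1.
have : #|A :&: PC n K|%:R ^+ 2 <= 4 * D ^+ 2 * (K%:R * ln K%:R) :> R.
  have -> : 4 * D ^+ 2 * (K%:R * ln K%:R) = zeta (2 * D) K ^+ 2.
    rewrite /zeta -[in LHS](sqr_sqrtr (ltW kl0)); ring.
  by rewrite lerXn2r ?nnegrE// (le_trans _ Az).
have -> : 4 * D ^+ 2 * (K%:R * ln K%:R) = kappa * (K%:R * ln K%:R) / 4.
  by rewrite /kappa /D; field.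
have -> : kappa / 8 * K%:R * ln K%:R = kappa * (K%:R * ln K%:R) / 8 by ring.
have : 0 <= #|A :&: PC n K|%:R :> R by [].
have : 0 < kappa * (K%:R * ln K%:R) by exact: mulr_gt0 kappa0 kl0.
move: (_ * (K%:R * _)) (#|_|%:R : R) r2 B (upper_thr _ _ _) (ZR _ _) ('C(K, 2)%:R : R) => *; lra.
Qed.

Lemma maxPsiBern_le_r1 : (maxPsiBern K w (zeta D K) (zeta (2 * D) K))%:R <= r1.
Proof.
have r10 := r1_gt0.
rewrite -(truncn_ge_nat _ (ltW r10)).
apply/bigmax_leqP_seq => y _ /andP[y1 y2]; apply/bigmax_leqP => A /andP[/eqP AK /eqP Ay].
by rewrite (truncn_ge_nat _ (ltW r10)); apply: nedges_le_r1 => //; rewrite Ay.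
Qed.

End Deterministic.
End OGPproof.

Theorem theorem2p13 (R : realType)
  (Hconj : forall alpha : R, 1 / 2 <= alpha -> alpha < 2 / 3 ->
     unplanted_lower_bound (R := R) (Kpow alpha)) :
  exists2 C0 : R, 0 < C0 &
  forall alpha : R, 1 / 2 <= alpha -> alpha < 2 / 3 ->
  let K := Kpow alpha in
  exists C1 D1 D2 : R,
  [/\ 0 < C1,
      0 < D1 /\ D1 < D2,
      (* every use of PsiBern below is in its domain for large n *)
      \forall n \near \oo,
        [/\ admissible_overlap n (K n) (low_overlap C0 n (K n)),
            admissible_overlap n (K n) (K n %/ 2) &
            forall z : nat, zeta D1 (K n) <= z%:R -> z%:R <= zeta D2 (K n) ->
              admissible_overlap n (K n) z],
      whp R (fun n => [set w : coins n |
        (maxPsiBern (K n) w (zeta D1 (K n)) (zeta D2 (K n)))%:R <=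
        (minn (PsiBern (K n) w (low_overlap C0 n (K n)))
              (PsiBern (K n) w (K n %/ 2)))%:R - C1 * (K n)%:R * ln (K n)%:R]) &
      OGP K (fun n => zeta D1 (K n)) (fun n => zeta D2 (K n))
        (r1_thr C0 C1 K) (r2_thr C0 K)].
Proof.
exists 4 => // alpha alpha_ge alpha_lt K.
pose c : R := (1 - 3 / 2 * alpha) / 2; have c0 : 0 < c by rewrite /c; lra.
pose D := c / 16 / 48; have D0 : 0 < D by apply: divr_gt0 => //; exact: divr_gt0.
have overlaps := near_overlaps alpha_ge alpha_lt D0.
have good := whpI (whpI (whp_upper alpha_ge alpha_lt D0)
  (whp_low alpha_ge alpha_lt D0 (Hconj _ alpha_ge alpha_lt)))
  (whp_high alpha_ge alpha_lt D0).
have large : \forall n \near \oo,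
    [/\ 0 < ln (K n)%:R :> R, 0 < (K n)%:R :> R & ln (K n)%:R <= ln n%:R :> R].
  near=> n.
  have k2 : 2 <= (K n)%:R :> R by near: n; exact: near_Kpow_ge.
  have kn : 1 * (K n)%:R <= n%:R :> R by near: n; exact: near_Kpow_le_id.
  by split; [rewrite ln_gt0//; lra|lra|rewrite ler_ln ?posrE//; lra].
exists (c * D / 48 / 8), D, (2 * D); split.
- by do 2 (apply: divr_gt0 => //); exact: mulr_gt0.
- by split=> //; lra.
- apply: filterS overlaps => n [z0 zh zK lz Kz].
  have Dz : zeta D (K n) <= zeta (2 * D) (K n).
    by rewrite ler_wpM2r ?sqrtr_ge0//; lra.
  have Kzn (y : nat) : zeta D (K n) <= y%:R -> (K n ^ 2 %/ n <= y)%N.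
    by move=> zy; rewrite (leq_trans Kz)// -(ler_nat R) (le_trans lz).
  rewrite /admissible_overlap Kz/= Kzn ?leq_div//; last exact: le_trans Dz zh.
  split=> //; first by rewrite -(ler_nat R); lra.
  by move=> y zy yz; rewrite Kzn//= -(ler_nat R); lra.
- apply: (whpS good); apply: filterS large => n [lnK0 K0 lnKn] w [[up lo] hi] /=.
  exact: maxPsiBern_le_r1.
split.
- apply: filterS overlaps => n [z0 zh zK lz Kz]; split => //; split=> //.
  rewrite /zeta -mulrA ltr_pMl//; lra.
- apply: (whpS good); apply: filterS large => n [lnK0 K0 lnKn] w [[up lo] hi] /=.
  by split; [exact: r1_gt0|exact: r1_lt_r2].
- apply: (whpS good); apply: filterS2 large overlaps => n [lnK0 K0 lnKn].
  move=> [z0 zh zK lz Kz] w [[up lo] hi] /=; split; last first.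
    by move=> A; exact: nedges_le_r1.
  have [S [SK Sz _]] := lo; have [T [TK Tz _]] := hi.
  have [A [AK Az AE]] := PsiBern_attained w SK Sz.
  have [A' [A'K A'z A'E]] := PsiBern_attained w TK Tz.
  exists A, A'; split => //.
  + rewrite Az A'z; split=> //; split => //.
    by rewrite /zeta -mulrA ltr_pMl//; lra.
  + by rewrite AE ler_nat geq_minl.
  + by rewrite A'E ler_nat geq_minr.
Unshelve. all: by end_near. Qed.
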